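(* Let $P$ be a cubical $d$-polytope and let $F$ be a proper face of $P$. Then the subgraph $G(P)-V(F)$ is $(d-2)$-connected.
   Context: A cube is any polytope combinatorially equivalent to a standard cube (i.e. its face lattice is isomorphic to the face lattice of a standard cube). A cubical $d$-polytope is a $d$-dimensional (convex) polytope all of whose facets are cubes. The graph $G(P)$ of a polytope $P$ is the graph formed by its vertices and edges (1-dimensional faces), and $V(F)$ is the set of vertices of the face $F$. For a set $X$ of vertices of a graph $G$, $G-X$ is the subgraph of $G$ induced by the vertices not in $X$. A graph is $k$-connected if it has more than $k$ vertices and removing any set of fewer than $k$ vertices leaves a connected graph. *)

(* Defs.v *)
From HB Require Import structures.
From mathcomp Require Import all_boot all_order all_algebra.
From mathcomp Require Import boolp classical_sets functions cardinality reals.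
From mathcomp Require Import convex.

Set Implicit Arguments.
Unset Strict Implicit.
Unset Printing Implicit Defensive.

Import GRing.Theory.

Local Open Scope classical_set_scope.
Local Open Scope ring_scope.

Section Polytopes.
Context {R : realType}.

Definition conv_hull n (A : set 'rV[R]_n) : set 'rV[R]_n :=
  smallest (@convex_set R 'rV[R]_n) A.

Definition aff_hull n (A : set 'rV[R]_n) : set 'rV[R]_n :=
  [set x | exists m (p : 'I_m -> 'rV[R]_n) (w : 'I_m -> R),
     [/\ forall i, A (p i), \sum_i w i = 1 & x = \sum_i w i *: p i]].

(* The dimension of the affine hull; the empty set has no dimension in this
   sense, its affine hull being empty. *)
Definition has_dim n (A : set 'rV[R]_n) (k : nat) : Prop :=
  exists (x : 'rV[R]_n) (U : {vspace 'rV[R]_n}),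
    \dim U = k /\ aff_hull A = [set x + u | u in [set` U]].

Definition is_polytope n (P : set 'rV[R]_n) : Prop :=
  exists A : set 'rV[R]_n, finite_set A /\ P = conv_hull A.

(* [c] may be zero, so that P and the empty set are faces of P. *)
Definition is_face n (P F : set 'rV[R]_n) : Prop :=
  exists (c : 'cV[R]_n) (b : R),
    (forall x, P x -> (x *m c) 0 0 <= b) /\
    F = P `&` [set x | (x *m c) 0 0 = b].

(* The empty face is proper. *)
Definition is_proper_face n (P F : set 'rV[R]_n) : Prop :=
  is_face P F /\ F <> P.

Definition is_facet n (P F : set 'rV[R]_n) : Prop :=
  is_face P F /\ exists k, has_dim F k /\ has_dim P k.+1.

Definition is_edge n (P E : set 'rV[R]_n) : Prop :=
  is_face P E /\ has_dim E 1.

Definition vertices n (P : set 'rV[R]_n) : set 'rV[R]_n :=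
  [set v | is_face P [set v]].

(* An order isomorphism between the face lattices. *)
Definition comb_equiv n m (P : set 'rV[R]_n) (Q : set 'rV[R]_m) : Prop :=
  exists phi : set 'rV[R]_n -> set 'rV[R]_m,
    set_bij [set F | is_face P F] [set G | is_face Q G] phi /\
    forall F G, is_face P F -> is_face P G ->
      (F `<=` G <-> phi F `<=` phi G).

Definition std_cube k : set 'rV[R]_k := [set x | forall i, 0 <= x 0 i <= 1].

Definition is_cube n (C : set 'rV[R]_n) : Prop :=
  is_polytope C /\ exists k, comb_equiv C (@std_cube k).

Definition is_cubical_polytope n (d : nat) (P : set 'rV[R]_n) : Prop :=
  [/\ is_polytope P, has_dim P d & forall F, is_facet P F -> is_cube F].

End Polytopes.

Record graph (T : Type) := Graph {
  gverts : set T;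
  gadj : T -> T -> Prop;
  gadj_vert : forall u v, gadj u v -> gverts u;
  gadj_sym : forall u v, gadj u v -> gadj v u;
  gadj_irr : forall u, ~ gadj u u }.

Section Graphs.
Context {T : Type}.
Implicit Types (G : graph T) (X : set T).

Lemma gminus_vert G X u v :
  [/\ gadj G u v, ~ X u & ~ X v] -> (gverts G `\` X) u.
Proof. by case=> Guv Xu _; split=> //; apply: gadj_vert Guv. Qed.

Lemma gminus_sym G X u v :
  [/\ gadj G u v, ~ X u & ~ X v] -> [/\ gadj G v u, ~ X v & ~ X u].
Proof. by case=> Guv Xu Xv; split=> //; apply: gadj_sym. Qed.

Lemma gminus_irr G X u : ~ [/\ gadj G u u, ~ X u & ~ X u].
Proof. by case=> Guu _ _; apply: gadj_irr Guu. Qed.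

Definition gminus G X : graph T :=
  Graph (@gminus_vert G X) (@gminus_sym G X) (@gminus_irr G X).

Definition gconnected G : Prop :=
  forall u v, gverts G u -> gverts G v ->
    exists s : seq T, path (fun x y => `[< gadj G x y >]) u s /\ last u s = v.

(* The two cardinality conditions read |V(G)| > k and |X| < k. *)
Definition gkconnected (k : nat) G : Prop :=
  ~~ (gverts G #<= `I_k)%card /\
  forall X, X `<=` gverts G -> ~~ (`I_k #<= X)%card -> gconnected (gminus G X).

End Graphs.

Section PolytopeGraph.
Context {R : realType} {n : nat}.
Implicit Types (P : set 'rV[R]_n) (u v : 'rV[R]_n).

Definition polytope_adj P u v : Prop :=
  [/\ vertices P u, vertices P v, u <> v & is_edge P (conv_hull [set u; v])].

Lemma polytope_adj_vert P u v : polytope_adj P u v -> vertices P u.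
Proof. by case. Qed.

Lemma polytope_adj_sym P u v : polytope_adj P u v -> polytope_adj P v u.
Proof. by case=> Pu Pv /nesym uv E; split=> //; rewrite setUC. Qed.

Lemma polytope_adj_irr P u : ~ polytope_adj P u u.
Proof. by case. Qed.

Definition polytope_graph P : graph 'rV[R]_n :=
  Graph (@polytope_adj_vert P) (@polytope_adj_sym P) (@polytope_adj_irr P).

End PolytopeGraph.

(* Main.v *)
Require Import Defs.
From mathcomp Require Import boolp classical_sets functions cardinality reals.
From mathcomp Require Import interval_inference convex.
From mathcomp Require Import all_boot all_order all_algebra.
From mathcomp Require Import ring zify.

(** For d <= 2 the claim is that some vertex lies outside F: maximize a linear
functional that F minimizes (vertex_outside).

Let d >= 3, let Z be the face to be removed, X a set of at most d - 3 further
vertices, and choose a facet F containing Z. Three facts give connectedness.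

Inside a facet C other than F: C is a cube of dimension at least d - 1 and Z meets it
in a proper, possibly empty, face, and what is left of its graph after removing this
face and X is connected. Indeed the vertices of a cube outside a nonempty face are
covered by facets of the cube which avoid the face; each of them is a highly
connected smaller cube, and any two of them share more vertices than X can remove
(subcube_connected, cube_minus_connected).

Between facets: the facets other than F can be joined by sequences in which
consecutive facets share a ridge not contained in F (facets_linked). This is the
dual form of the fact that a polytope graph stays connected when a vertex is
deleted, and it is proved by the simplex method on facets: from C one rotates about
a ridge of C to a facet of larger objective (rotate_facet, pivot). A ridge not
contained in F has at least 2 ^ (d - 3) vertices outside Z, so one of them survives
(ridge_kept) and the walks in the two facets can be concatenated.

Everywhere: each vertex lies in a facet other than F (vertex_facet).

The theory of faces is developed for a finite family of points and the functionals
nonnegative on it. The basic step is the ratio test (min_ratio): subtracting from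
a functional the largest admissible multiple of another one enlarges its zero set.
It yields that a maximal proper zero set determines its functional up to scaling,
hence has codimension one, and that every nonnegative functional is a sum of
those defining facets (facet_fun_gen). No separation theorem is involved.

The assumption that facets are cubes concerns face lattices only. It is turned into
a naming of the vertices of a facet by bit vectors in which faces are subcubes
(cube_labelling); that neighbouring bit vectors span genuine edges, and that the
cube has dimension at least d - 1, is recovered from the face order (label_edge,
dim_label). *)

Set Implicit Arguments.
Unset Strict Implicit.
Unset Printing Implicit Defensive.

Import Order.TTheory GRing.Theory Num.Theory.

Local Open Scope ring_scope.

(** * Faces of a finite point configuration *)

Section Configurations.
Context {R : realType} {m : nat} {I : finType} (p : I -> 'rV[R]_m).
Implicit Types (f g h r : 'cV[R]_m) (i j : I) (S T Z B C D : {set I}).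

(** The points are homogeneous coordinates (a leading 1 is prepended in the
geometric use), so that linear functionals stand for affine ones and faces of
the convex hull become zero sets of nonnegative functionals. *)
Definition ev f i : R := (p i *m f) 0 0.

Lemma evD f g i : ev (f + g) i = ev f i + ev g i.
Proof. by rewrite /ev mulmxDr mxE. Qed.

Lemma evZ t f i : ev (t *: f) i = t * ev f i.
Proof. by rewrite /ev -scalemxAr mxE. Qed.

Lemma evN f i : ev (- f) i = - ev f i.
Proof. by rewrite /ev mulmxN mxE. Qed.

Lemma ev0 i : ev 0 i = 0.
Proof. by rewrite /ev mulmx0 mxE. Qed.

Definition valid T f := forall i, i \in T -> 0 <= ev f i.
Definition zset T f := [set i in T | ev f i == 0].
Definition iface T Z := exists2 f, valid T f & Z = zset T f.
Definition ifacet T Z :=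
  [/\ iface T Z, Z != T & forall D, iface T D -> Z \subset D -> D != T -> D = Z].
Definition facet_fun T f := valid T f /\ ifacet T (zset T f).

Lemma zsetP T f i : reflect (i \in T /\ ev f i = 0) (i \in zset T f).
Proof. by rewrite inE; apply: (iffP andP) => -[-> /eqP]. Qed.

Lemma zset_sub T f : zset T f \subset T.
Proof. by apply/subsetP => i /zsetP[]. Qed.

Lemma iface_sub T Z : iface T Z -> Z \subset T.
Proof. by case=> f _ ->; apply: zset_sub. Qed.

Lemma iface_refl T : iface T T.
Proof.
exists 0 => [i _|]; first by rewrite ev0.
by apply/setP=> i; rewrite inE ev0 eqxx andbT.
Qed.

Lemma zset_neq T f : zset T f != T -> exists2 i, i \in T & ev f i != 0.
Proof.
move=> nT; have /subsetPn[i iT iZ] : ~~ (T \subset zset T f).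
  by apply: contra nT => sT; rewrite eqEsubset zset_sub.
by exists i => //; apply: contra iZ => /eqP fi; apply/zsetP.
Qed.

Lemma zset_eqT T f : zset T f = T -> forall i, i \in T -> ev f i = 0.
Proof. by move=> e i; rewrite -{1}e => /zsetP[]. Qed.

Lemma valid_gt0 T f i : valid T f -> i \in T -> i \notin zset T f -> 0 < ev f i.
Proof. by move=> vf iT; rewrite inE iT /= lt_neqAle eq_sym => ->; apply: vf. Qed.

Lemma zset_ev T f i : i \in zset T f -> ev f i = 0.
Proof. by case/zsetP. Qed.

(** Used to extend functionals from a face: S is then the complement of the face
and f a functional defining it. *)
Lemma add_multiple_gt0 S f h : (forall i, i \in S -> 0 < ev f i) ->
  exists s, forall i, i \in S -> 0 < ev (h + s *: f) i.
Proof.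
move=> f0; exists (1 + \sum_(j in S) `|ev h j| / ev f j) => i iS.
rewrite evD evZ (bigD1 i) //= mulrDl mul1r mulrDl divfK ?gt_eqF ?f0 //.
have h1 : 0 <= (\sum_(j in S | j != i) `|ev h j| / ev f j) * ev f i.
  apply: mulr_ge0; last by rewrite ltW ?f0.
  apply: sumr_ge0 => j /andP[jS _].
  by rewrite divr_ge0 // ltW ?f0.
have h2 : 0 <= ev h i + `|ev h i|.
  by have := ler_norm (- ev h i); rewrite normrN -subr_ge0 opprK addrC.
rewrite addrCA; apply: ltr_wpDr; last exact: f0.
by rewrite addrA addr_ge0.
Qed.

(** Subtract the largest multiple of g that keeps f nonnegative; a point where
the minimal ratio f / g is attained joins the zero set. *)
Lemma min_ratio T f g : valid T f -> valid T g -> zset T g != T ->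
    zset T f \subset zset T g ->
  exists2 t, 0 < t & [/\ valid T (f - t *: g),
    zset T f \subset zset T (f - t *: g) &
    exists2 i, i \in zset T (f - t *: g) & i \notin zset T f].
Proof.
move=> vf vg gT fg.
have /subsetPn[i0 i0T i0g] : ~~ (T \subset zset T g).
  by apply: contra gT => sT; rewrite eqEsubset zset_sub.
pose Q := fun i => (i \in T) && (i \notin zset T g).
have Q0 : Q i0 by rewrite /Q i0T.
case: (@Order.TotalTheory.arg_minP _ _ I i0 Q (fun i => ev f i / ev g i) Q0)
  => i1 /andP[i1T i1g] mn.
have g1 : 0 < ev g i1 by apply: valid_gt0 i1g.
have i1f : i1 \notin zset T f by apply: contra i1g; apply/subsetP.
have f1 : 0 < ev f i1 by apply: valid_gt0 i1f.
exists (ev f i1 / ev g i1); first by rewrite divr_gt0.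
have evE i : ev (f - (ev f i1 / ev g i1) *: g) i
    = ev f i - ev f i1 / ev g i1 * ev g i by rewrite evD evN evZ.
split.
- move=> i iT; rewrite evE subr_ge0.
  have [ig|ig] := boolP (i \in zset T g).
    by rewrite (zset_ev ig) mulr0 vf.
  by rewrite -ler_pdivlMr ?(valid_gt0 vg iT ig) // mn // /Q iT.
- apply/subsetP=> i iZ; apply/zsetP; split; first by case/zsetP: iZ.
  by rewrite evE (zset_ev iZ) (zset_ev (subsetP fg i iZ)) mulr0 subr0.
- by exists i1 => //; apply/zsetP; split=> //; rewrite evE divfK ?subrr ?gt_eqF.
Qed.

(** Otherwise the minimal ratio step would give a larger proper zero set. *)
Lemma facet_fun_unique T f g : facet_fun T f -> valid T g ->
  zset T g = zset T f -> exists2 t, 0 < t & forall i, i \in T -> ev g i = t * ev f i.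
Proof.
move=> [vf [_ fT mx]] vg gf.
have [|t t0 [vh sub [i iZ inZ]]] := min_ratio vg vf fT; first by rewrite gf.
exists t => // j jT; apply/eqP; rewrite -subr_eq0 -evZ -evN -evD; apply/eqP.
apply: (@zset_eqT T) => //; apply/eqP/negPn/negP => hT.
have E : zset T (g - t *: f) = zset T f.
  by apply: mx => //; [exists (g - t *: f)|rewrite -gf].
by move: inZ; rewrite gf -E iZ.
Qed.

(** Adding a large multiple of f makes h nonnegative with the zero set of f, so
uniqueness applies. This says that a facet spans a hyperplane. *)
Lemma facet_fun_span T f h : facet_fun T f ->
    (forall i, i \in zset T f -> ev h i = 0) ->
  exists l, forall i, i \in T -> ev h i = l * ev f i.
Proof.
move=> ff h0; have [vf _] := ff.
have [|s hs] := @add_multiple_gt0 (T :\: zset T f) f h.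
  by move=> i /setDP[iT iZ]; apply: valid_gt0 iZ.
have zE i : i \in zset T f -> ev (h + s *: f) i = 0.
  by move=> iZ; rewrite evD evZ h0 // (zset_ev iZ) mulr0 addr0.
have vg : valid T (h + s *: f).
  move=> i iT; have [iZ|iZ] := boolP (i \in zset T f); first by rewrite zE.
  by rewrite ltW // hs // inE iZ.
have [|t t0 tE] := facet_fun_unique ff vg.
  apply/setP=> i; apply/idP/idP => [/zsetP[iT i0]|iZ]; last first.
    by apply/zsetP; split; [case/zsetP: iZ|apply: zE].
  apply/negPn/negP => iZ; have := hs i; rewrite in_setD iZ iT => /(_ isT).
  by rewrite i0 ltxx.
exists (t - s) => i iT; have := tE i iT; rewrite evD evZ mulrBl => <-.
by rewrite addrK.
Qed.

Lemma not_ifacet T Z : iface T Z -> Z != T -> ~ ifacet T Z ->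
  exists D, [/\ iface T D, Z \proper D & D != T].
Proof.
move=> fZ ZT nf; apply: contrapT => nD; apply: nf; split=> // D fD ZD DT.
apply/eqP/negPn/negP=> DZ; apply: nD; exists D; split=> //.
by rewrite properEneq eq_sym DZ.
Qed.

Lemma sub_ifacet T Z : iface T Z -> Z != T -> exists2 D, ifacet T D & Z \subset D.
Proof.
have [k] := ubnP (#|T| - #|Z|); elim: k Z => // k IH Z le_k fZ ZT.
have [fc|/(not_ifacet fZ ZT)[D [fD ZD DT]]] := pselect (ifacet T Z); first by exists Z.
have [|E fE DE] := IH D _ fD DT.
  have := proper_card ZD; have := subset_leq_card (iface_sub fD); lia.
by exists E => //; apply: subset_trans DE; apply: proper_sub.
Qed.

(** The dual description of a polytope: unless f already defines a facet, some
face properly contains its zero set, and the minimal ratio step writes f as a sum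
of two functionals with larger zero sets. *)
Lemma facet_fun_gen T f : valid T f ->
  exists gs : seq 'cV[R]_m, (forall g, g \in gs -> facet_fun T g) /\
    forall i, i \in T -> ev f i = \sum_(g <- gs) ev g i.
Proof.
have [k] := ubnP (#|T| - #|zset T f|); elim: k f => // k IH f le_k vf.
have [fT|fT] := eqVneq (zset T f) T.
  by exists [::]; split=> // i iT; rewrite big_nil (zset_eqT fT).
have ff : iface T (zset T f) by exists f.
have [fc|/(not_ifacet ff fT)[D [[g vg ->] fg gT]]] := pselect (ifacet T (zset T f)).
  exists [:: f]; split=> [g|i iT]; last by rewrite big_seq1.
  by rewrite inE => /eqP->.
have [t t0 [vh sub [i iZ inZ]]] := min_ratio vf vg gT (proper_sub fg).
have cT h : (#|zset T h| <= #|T|)%N by apply/subset_leq_card/zset_sub.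
have [|gs1 [h1 e1]] := IH (f - t *: g) _ vh.
  have : (#|zset T f| < #|zset T (f - t *: g)|)%N.
    by apply: proper_card; apply/properP; split=> //; exists i.
  have := cT (f - t *: g); lia.
have zg : zset T (t *: g) = zset T g.
  by apply/setP=> j; rewrite !inE evZ mulf_eq0 gt_eqF.
have [||gs2 [h2 e2]] := IH (t *: g).
- have := proper_card fg; have := cT g; rewrite zg; lia.
- by move=> j jT; rewrite evZ; apply: mulr_ge0; [exact: ltW|exact: vg].
exists (gs1 ++ gs2); split=> [g'|j jT].
  by rewrite mem_cat => /orP[/h1|/h2].
by rewrite big_cat /= -e1 // -e2 // -evD subrK.
Qed.


(** The facet functionals that sum to a functional of Z do not all define F, since
the common zero set Z would then be F. *)
Lemma sub_ifacet_neq T F Z : iface T Z -> Z != T -> ifacet T F -> Z != F ->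
  exists D, [/\ ifacet T D, D != F & Z \subset D].
Proof.
move=> fZ ZT [_ FT mx] ZF; have [f vf ZE] := fZ.
have [gs [gsF gsE]] := facet_fun_gen vf.
have ZD g : g \in gs -> Z \subset zset T g.
  move=> gin; apply/subsetP=> i; rewrite ZE => iZ; have iT : i \in T by case/zsetP: iZ.
  have := gsE i iT; rewrite (zset_ev iZ) big_seq => /esym s0.
  apply/zsetP; split=> //; apply/eqP.
  move/eqP: s0; rewrite psumr_eq0 => [/allP/(_ g gin)|h /gsF[vh _]]; last exact: vh.
  by rewrite gin.
have [[g gin gF]|all] := pselect (exists2 g, g \in gs & zset T g != F).
  by exists (zset T g); split=> //; [case: (gsF g gin)|apply: ZD].
case/negP: ZF; apply/eqP/mx => //; apply/subsetP=> i iF.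
have gF g : g \in gs -> zset T g = F.
  by move=> gin; apply/eqP/negPn/negP => ne; apply: all; exists g.
have iT : i \in T.
  case: gs gsF gF gsE ZD {all} => [|g gs] gsF gF gsE ZD.
    case/negP: ZT; rewrite eqEsubset (iface_sub fZ) /=.
    by apply/subsetP=> j jT; rewrite ZE; apply/zsetP; rewrite gsE ?big_nil.
  by move: iF; rewrite -(gF g (mem_head _ _)) => /zsetP[].
rewrite ZE; apply/zsetP; split=> //; rewrite gsE // big_seq big1 // => g gin.
by apply: (@zset_ev T); rewrite gF.
Qed.

Lemma iface_restrict T C Z : C \subset T -> iface T Z -> iface C (Z :&: C).
Proof.
move=> CT [f vf ->]; exists f => [i iC|]; first exact: vf (subsetP CT i iC).
apply/setP=> i; rewrite !inE; have [iC|] := boolP (i \in C); last by rewrite andbF.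
by rewrite (subsetP CT i iC) andbT.
Qed.

Lemma zset_restrict T C f : C \subset T -> zset C f = zset T f :&: C.
Proof.
move=> CT; apply/setP=> i; rewrite !inE.
have [iC|] := boolP (i \in C); last by rewrite andbF.
by rewrite (subsetP CT i iC) andbT.
Qed.

(** A functional on a face may be negative outside it; adding a large multiple of
f repairs this without changing it on the face. *)
Lemma valid_ext T f r : valid T f -> valid (zset T f) r ->
  exists y, [/\ valid T y, zset T y = zset (zset T f) r &
    forall i, i \in zset T f -> ev y i = ev r i].
Proof.
move=> vf vr; have [|s hs] := @add_multiple_gt0 (T :\: zset T f) f r.
  by move=> i /setDP[iT iZ]; apply: valid_gt0 iZ.
have yE i : i \in zset T f -> ev (r + s *: f) i = ev r i.
  by move=> iZ; rewrite evD evZ (zset_ev iZ) mulr0 addr0.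
have y0 i : i \in T -> i \notin zset T f -> 0 < ev (r + s *: f) i.
  by move=> iT iZ; apply: hs; rewrite inE iZ.
exists (r + s *: f); split=> //.
  move=> i iT; have [iZ|iZ] := boolP (i \in zset T f); first by rewrite yE // vr.
  by rewrite ltW // y0.
apply/setP=> i; apply/zsetP/zsetP=> -[iT e].
  have iZ : i \in zset T f by apply/negPn/negP=> /(y0 i iT); rewrite e ltxx.
  by rewrite -(yE i).
by split; [case/zsetP: iT|rewrite yE].
Qed.

Lemma iface_trans T C Z : iface T C -> iface C Z -> iface T Z.
Proof.
move=> [f vf ->] [r vr ->]; have [y [vy yE _]] := valid_ext vf vr.
by exists y.
Qed.

Lemma ifacet_fun T C : ifacet T C -> exists2 f, facet_fun T f & C = zset T f.
Proof.
by move=> fC; have [[f vf CE] _ _] := fC; exists f => //; rewrite /facet_fun -CE.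
Qed.

Lemma ifacet_sub T C D : ifacet T C -> ifacet T D -> C \subset D -> C = D.
Proof. by move=> [_ _ mx] [fD DT _] CD; rewrite (mx D). Qed.

(** Tilting the supporting hyperplane of the facet C about a ridge of C until it
hits a new point gives the unique other facet through the ridge. *)
Lemma rotate_facet T f r : facet_fun T f -> facet_fun (zset T f) r ->
  exists g, [/\ facet_fun T g, forall i, i \in zset T f -> ev g i = ev r i &
    forall D, ifacet T D -> D != zset T f -> zset (zset T f) r \subset D ->
      D = zset T g].
Proof.
set C := zset T f => ff fr; have [vf fC] := ff; have [vr fB] := fr.
have CT : C \subset T := zset_sub T f.
have CnT : C != T by case: fC.
have [y [vy yZ yE]] := valid_ext vf vr.
have [|t t0 [vg sub [i iZ inB]]] := min_ratio vy vf CnT.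
  by rewrite yZ zset_sub.
set g := y - t *: f in vg sub iZ.
have gE j : j \in C -> ev g j = ev r j.
  by move=> jC; rewrite evD evN evZ (zset_ev jC) mulr0 subr0 yE.
have iT : i \in T by case/zsetP: iZ.
have gi : ev g i = 0 by apply: zset_ev iZ.
have iC : i \notin C.
  by apply: contra inB => iC; rewrite yZ; apply/zsetP; split=> //; rewrite -gE.
have fi : 0 < ev f i by apply: valid_gt0 iC.
have gB : zset C r \subset zset T g.
  by apply/subsetP=> j /zsetP[jC rj]; apply/zsetP; rewrite gE // (subsetP CT).
(* On C, a functional of a face that contains the ridge but not C is a multiple
   of r; hence on T it is determined up to a multiple of f. *)
have key h : valid T h -> zset C r \subset zset T h -> ~~ (C \subset zset T h) ->
    exists s l, [/\ 0 < s, 0 <= l, l * ev f i = ev h i &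
      forall j, j \in T -> ev h j = s * ev g j + l * ev f j].
  move=> vh Bh nC; have vhC : valid C h by move=> j /(subsetP CT); apply: vh.
  have hB : zset C h = zset C r.
    case: fB => _ _; apply; first by exists h.
      by rewrite (zset_restrict h CT) subsetI Bh zset_sub.
    apply: contra nC => /eqP e; rewrite -e (zset_restrict h CT); exact: subsetIl.
  have [s s0 sE] := facet_fun_unique fr vhC hB.
  have [|l lE] := @facet_fun_span T f (h - s *: g) ff.
    by move=> j jC; rewrite evD evN evZ gE // sE // subrr.
  have hE j : j \in T -> ev h j = s * ev g j + l * ev f j.
    by move=> jT; rewrite -lE // evD evN evZ addrC subrK.
  have li : l * ev f i = ev h i by rewrite hE // gi mulr0 add0r.
  by exists s, l; split=> //; rewrite -(pmulr_lge0 _ fi) li vh.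
have nCsub D : D != T -> iface T D -> i \in D -> ~~ (C \subset D).
  move=> DT fD iD; apply: contra iC => CD; case: fC => _ _ mx.
  by rewrite /C -(mx D).
exists g; split=> //.
  split=> //; split; first by exists g.
    apply: contraNneq iC => gT; rewrite /C.
    have gj := zset_eqT gT.
    have CB : zset C r = C.
      apply/setP=> j; rewrite inE; case: (boolP (j \in C)) => //= jC.
      by rewrite -gE // gj ?eqxx // (subsetP CT).
    by case: fB => _; rewrite CB eqxx.
  move=> D fD gD DT; have [h vh DE] := fD; rewrite DE in gD DT *.
  have ih := subsetP gD _ iZ.
  have [||s [l [s0 l0 li hE]]] := key h vh; first exact: subset_trans gB gD.
    by apply: nCsub => //; exists h.
  have l00 : l = 0.
    by move/eqP: li; rewrite (zset_ev ih) mulf_eq0 (gt_eqF fi) orbF => /eqP.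
  apply/setP=> j; rewrite !inE; case: (boolP (j \in T)) => //= jT.
  by rewrite hE // l00 mul0r addr0 mulf_eq0 gt_eqF.
move=> D fD DC BD; have [[h vh DE] DT mxD] := fD; rewrite DE in fD DC BD DT mxD *.
have nC : ~~ (C \subset zset T h).
  by apply: contraNN DC => Ch; apply/eqP/esym; exact: (ifacet_sub fC fD Ch).
have [s [l [s0 l0 li hE]]] := key h vh BD nC.
have z j : j \in zset T h -> ev g j = 0 /\ l * ev f j = 0.
  move=> jh; have jT : j \in T by case/zsetP: jh.
  have := hE j jT; rewrite (zset_ev jh) => /esym/eqP.
  rewrite paddr_eq0 ?mulr_ge0 ?vg ?vf // ?(ltW s0) //.
  by case/andP=> /eqP/eqP; rewrite mulf_eq0 (gt_eqF s0) => /eqP -> /eqP.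
have [l00|ln0] := eqVneq l 0; last first.
  case/negP: DC; apply/eqP; apply: (ifacet_sub fD fC).
  apply/subsetP=> j jh; apply/zsetP; split; first by case/zsetP: jh.
  by have [_ /eqP] := z j jh; rewrite mulf_eq0 (negbTE ln0) => /eqP.
apply/setP=> j; rewrite !inE; case: (boolP (j \in T)) => //= jT.
by rewrite hE // l00 mul0r addr0 mulf_eq0 gt_eqF.
Qed.

End Configurations.

(** * Adjacent facets *)

Section Linking.
Context {R : realType} {m : nat} {I : finType} (p : I -> 'rV[R]_m).
Implicit Types (f g h r : 'cV[R]_m) (i j : I) (S T Z B C D : {set I}).

Definition total S f : R := \sum_(i in S) ev p f i.

Lemma total_ge0 T S f : S \subset T -> valid p T f -> 0 <= total S f.
Proof. by move=> ST vf; apply: sumr_ge0 => i /(subsetP ST); apply: vf. Qed.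

Lemma total_gt0 T S f : S \subset T -> valid p T f ->
  ~~ (S \subset zset p T f) -> 0 < total S f.
Proof.
move=> ST vf /subsetPn[i iS iZ]; rewrite /total (bigD1 i) //=.
apply: ltr_wpDr; first by apply: sumr_ge0 => j /andP[/(subsetP ST)/vf].
exact: valid_gt0 (subsetP ST i iS) iZ.
Qed.

Lemma total_scale T S f g t : S \subset T ->
  (forall i, i \in T -> ev p g i = t * ev p f i) -> total S g = t * total S f.
Proof.
by move=> ST gE; rewrite /total mulr_sumr; apply: eq_bigr => i /(subsetP ST)/gE.
Qed.

Lemma total_facet0 T F f : ifacet p T F -> facet_fun p T f ->
  zset p T f != F -> 0 < total F f.
Proof.
move=> fF [vf ff]; have [iF _ _] := fF => ne; apply: total_gt0 vf _.
  exact: iface_sub iF.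
by apply: contra ne => s; apply/eqP/esym; exact: (ifacet_sub fF ff s).
Qed.

Lemma total_zset T f : total (zset p T f) f = 0.
Proof. by apply: big1 => i /zset_ev. Qed.

(** The comparison of total F / (total F + total G) at f and g, without the
denominators. *)
Definition higher F G f g := total F f * total G g < total F g * total G f.

(** A step of the dual simplex method, with objective
total F f / (total F f + total G f) for G = zset p T h. On the facet of f, h is a sum
of functionals defining ridges; so h is the sum of their rotations plus a multiple
of f, and as G has the largest objective, one rotation must improve on f. *)
Lemma pivot T F f h : ifacet p T F -> facet_fun p T f -> facet_fun p T h ->
    F != zset p T h -> zset p T f != zset p T h ->
  exists r g, [/\ facet_fun p (zset p T f) r, facet_fun p T g,
    forall i, i \in zset p T f -> ev p g i = ev p r i,
    forall D, ifacet p T D -> D != zset p T f ->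
      zset p (zset p T f) r \subset D -> D = zset p T g &
    higher F (zset p T h) f g].
Proof.
move=> fF ff fh FG CG; have [vh fG] := fh; have [vf fC] := ff.
set G := zset p T h; set C := zset p T f.
have CT : C \subset T by apply: zset_sub.
have GT : G \subset T by apply: zset_sub.
have FT : F \subset T by case: fF => /iface_sub.
have bf : 0 < total G f by exact: total_facet0 fG ff CG.
have ah : 0 < total F h by apply: (total_facet0 fF fh); rewrite eq_sym.
have [rs [rsC rsE]] := facet_fun_gen (fun i iC => vh i (subsetP CT i iC)).
have ex r : exists g, r \in rs -> [/\ facet_fun p T g,
    forall i, i \in C -> ev p g i = ev p r i &
    forall D, ifacet p T D -> D != C -> zset p C r \subset D -> D = zset p T g].
  have [rrs|] := boolP (r \in rs); last by exists 0.
  by have [g gP] := rotate_facet ff (rsC r rrs); exists g.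
have [rot rotP] := choice ex.
apply: contrapT => none.
have low r : r \in rs -> total F (rot r) * total G f <= total F f * total G (rot r).
  move=> rrs; have [fg gE gU] := rotP r rrs; rewrite leNgt; apply/negP=> hi.
  by apply: none; exists r, (rot r); split=> //; apply: rsC.
have [|l lE] := @facet_fun_span R m I p T f (h - \sum_(r <- rs) rot r) ff.
  move=> i iC; rewrite evD evN rsE // /ev mulmx_sumr summxE -sumrB.
  rewrite big_seq big1 // => r /rotP[_ gE _].
  by rewrite -[X in _ - X]/(ev p _ i) gE // subrr.
have tot S : S \subset T -> total S h = \sum_(r <- rs) total S (rot r) + l * total S f.
  move=> ST; rewrite -(total_scale ST lE) exchange_big /= -big_split /=.
  apply: eq_bigr => i _; rewrite evD evN /ev mulmx_sumr summxE.
  by rewrite addrC subrK.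
have : total F h * total G f <= total F f * total G h.
  rewrite !tot // !(mulrDl, mulrDr) mulrCA mulrA lerD2r.
  rewrite mulr_suml mulr_sumr big_seq [leRHS]big_seq.
  by apply: ler_sum => r; apply: low.
by rewrite [total G h]total_zset mulr0 leNgt mulr_gt0.
Qed.

(** Each pivot raises an objective whose only maximum is G and whose only minimum
is F, so the pivots end at G and never visit F. The ridges crossed are not in F
because a ridge lies in two facets only. *)
Lemma facets_linked T F G (Q : {set I} -> Prop) :
    ifacet p T F -> ifacet p T G -> F != G -> Q G ->
    (forall C D, ifacet p T C -> ifacet p T D -> ifacet p C (C :&: D) ->
      ~~ (C :&: D \subset F) -> Q D -> Q C) ->
  forall C, ifacet p T C -> C != F -> Q C.
Proof.
move=> fF fG FG QG step.
have FT : F \subset T by case: fF => /iface_sub.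
have GT : G \subset T by case: fG => /iface_sub.
pose U C := [set D | `[< exists f g, [/\ facet_fun p T f, facet_fun p T g,
  zset p T f = C, zset p T g = D & higher F G f g] >] ].
move=> C; have [k] := ubnP #|U C|; elim: k C => // k IH C le_k fC CF.
have [->//|CG] := eqVneq C G.
have [f ff CE] := ifacet_fun fC; have [h fh hE] := ifacet_fun fG.
rewrite CE hE in CG; have [vf _] := ff; have := FG; rewrite {1}hE => FG'.
have [r [g [fr fg gE gU hi]]] := pivot fF ff fh FG' CG.
rewrite -hE in hi.
have [vg fD] := fg.
have bf : 0 < total G f by apply: (total_facet0 fG ff); rewrite hE.
have ag : 0 < total F g.
  rewrite -(pmulr_lgt0 _ bf); apply: le_lt_trans hi.
  by apply: mulr_ge0; apply: (total_ge0 _ (T := T)).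
have DF : zset p T g != F.
  by apply: contraTneq ag => <-; rewrite total_zset ltxx.
have BE : C :&: zset p T g = zset p C r.
  rewrite CE; apply/setP=> i; rewrite !inE.
  case: (boolP (i \in T)) => //= iT; case: eqP => //= fi.
  by rewrite gE //; apply/zsetP.
apply: (step C (zset p T g)) => //.
- by rewrite BE CE; case: fr.
- rewrite BE CE; apply/negP=> /(gU F fF); rewrite -CE eq_sym => /(_ CF) e.
  by move: DF; rewrite -e eqxx.
apply: IH => //; rewrite ltnS in le_k; apply: leq_trans le_k.
apply: proper_card; apply/properP; split.
  apply/subsetP=> D; rewrite !inE => /asboolP[g' [d [fg' fd g'E dE hi']]].
  apply/asboolP; exists f, d; split=> //.
  have [vg' _] := fg'.
  have [t t0 tE] := facet_fun_unique fg vg' g'E.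
  have [vd _] := fd.
  move: hi'; rewrite /higher (total_scale FT tE) (total_scale GT tE).
  rewrite -mulrA [X in _ < X]mulrCA ltr_pM2l // => hi'.
  have bg : 0 < total G g.
    rewrite lt_neqAle (total_ge0 GT vg) andbT eq_sym.
    apply: contraTneq hi' => ->; rewrite mulr0 -leNgt.
    by apply: mulr_ge0; [apply: (total_ge0 FT vg)|apply: (total_ge0 GT vd)].
  rewrite -(ltr_pM2r bg); apply: (@le_lt_trans _ _ (total F g * total G d * total G f)).
    rewrite mulrAC [X in _ <= X]mulrAC.
    by apply: ler_wpM2r; [exact: total_ge0 GT vd|exact: ltW].
  by rewrite [X in _ < X]mulrAC ltr_pM2r.
exists (zset p T g); rewrite inE; first by apply/asboolP; exists f, g.
apply/asboolP=> -[g1 [g2 [[v1 f1] [v2 f2] e1 e2 hi']]].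
have [t1 t10 t1E] := facet_fun_unique fg v1 e1.
have [t2 t20 t2E] := facet_fun_unique fg v2 e2.
move: hi'; rewrite /higher (total_scale FT t1E) (total_scale GT t1E).
rewrite (total_scale FT t2E) (total_scale GT t2E).
set x := total F g; set y := total G g.
by rewrite (_ : t1 * x * (t2 * y) = t2 * x * (t1 * y)) ?ltxx //; ring.
Qed.

Definition ispan T : {vspace 'rV[R]_m} := <<[seq p i | i in T]>>%VS.

Lemma ispan_mem T i : i \in T -> p i \in ispan T.
Proof. by move=> iT; apply/memv_span/image_f. Qed.

Lemma ispan_sub T (W : {vspace 'rV[R]_m}) :
  (forall i, i \in T -> p i \in W) -> (ispan T <= W)%VS.
Proof. by move=> h; apply/span_subvP => _ /imageP[i iT ->]; apply: h. Qed.

Lemma separate (W : {vspace 'rV[R]_m}) (v : 'rV[R]_m) : v \notin W ->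
  exists2 f : 'cV[R]_m, (forall w, w \in W -> (w *m f) 0 0 = 0) & (v *m f) 0 0 != 0.
Proof.
move=> vW; pose g := (\1 - projv W)%VF.
have gx x : g x = x - projv W x by rewrite !lfun_simp.
have gE x k : (x *m col k (lin1_mx g)) 0 0 = g x 0 k.
  by rewrite colE mulmxA -colE mxE mul_rV_lin1.
have : g v != 0.
  apply: contra vW; rewrite gx subr_eq0 => /eqP ->; exact: memv_proj.
case/rV0Pn => k gk; exists (col k (lin1_mx g)); last by rewrite gE.
by move=> w wW; rewrite gE gx projv_id // subrr mxE.
Qed.

(** A point of T outside the right-hand span would be separated from it by a
functional vanishing on Z, hence a multiple of the facet functional; but that
multiple vanishes at p i. *)
Lemma facet_span T Z i : ifacet p T Z -> i \in T -> i \notin Z ->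
  ispan T = (ispan Z + <[p i]>)%VS.
Proof.
move=> fZ iT iZ; have [f ff ZE] := ifacet_fun fZ.
have ZT : Z \subset T by rewrite ZE zset_sub.
apply: subv_anti; apply/andP; split; last first.
  rewrite subv_add -memvE ispan_mem // andbT; apply: ispan_sub => j /(subsetP ZT).
  exact: ispan_mem.
apply: ispan_sub => j jT; apply/negPn/negP => /separate[h h0 hj].
have [|l lE] := facet_fun_span (h := h) ff.
  move=> k kZ; apply: h0; apply: subvP (addvSl _ _) _ _.
  by apply: ispan_mem; rewrite ZE.
have hi : ev p h i = 0 by apply: h0; apply: subvP (addvSr _ _) _ _; apply: memv_line.
have := lE i iT; rewrite hi => /esym/eqP; rewrite mulf_eq0 => /orP[/eqP l0|/eqP fi].
  by move: hj; rewrite -[X in X != 0]/(ev p h j) lE // l0 mul0r eqxx.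
by case/negP: iZ; rewrite ZE; apply/zsetP.
Qed.

Lemma facet_dim T Z : ifacet p T Z -> \dim (ispan T) = (\dim (ispan Z)).+1.
Proof.
move=> fZ; have [[f vf ZE] ZT _] := fZ; rewrite ZE in ZT.
have [i iT fi] := zset_neq ZT.
have iZ : i \notin Z by rewrite ZE; apply: contra fi => /zset_ev ->.
have [h h0 nz] : exists2 h : 'cV[R]_m,
    (forall w, w \in ispan Z -> (w *m h) 0 0 = 0) & (p i *m h) 0 0 != 0.
  apply: separate; apply/negP=> iW; case/negP: fi; apply/eqP.
  have : (ispan Z <= lker (linfun ((mulmxr f) : 'rV[R]_m -> 'M[R]_1)))%VS.
    apply: ispan_sub => j jZ; rewrite memv_ker lfunE /=.
    apply/eqP/matrixP=> a b; rewrite !ord1 [RHS]mxE; move: jZ; rewrite ZE; exact: zset_ev.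
  move/subvP/(_ _ iW); rewrite memv_ker lfunE /= => /eqP e.
  by rewrite /ev e mxE.
rewrite (facet_span fZ iT iZ) dimv_disjoint_sum.
  rewrite dim_vline; suff -> : p i != 0 by rewrite addn1.
  by apply: contraNneq nz => ->; rewrite mul0mx mxE.
apply/eqP; rewrite -subv0; apply/subvP=> w /memv_capP[wZ /vlineP[t wE]].
have := h0 _ wZ; rewrite wE -scalemxAl mxE => /eqP; rewrite mulf_eq0 (negbTE nz) orbF.
by move/eqP->; rewrite scale0r mem0v.
Qed.

End Linking.

(** * Convex hulls, faces and dimension *)

Section Hulls.
Local Open Scope classical_set_scope.
Local Open Scope ring_scope.
Context {R : realType} {n : nat}.
Implicit Types (A B : set 'rV[R]_n) (x y u v : 'rV[R]_n).

Lemma convex_setP A : @convex_set R 'rV[R]_n A <->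
  forall x y (t : R), 0 <= t -> t <= 1 -> A x -> A y -> A (t *: x + (1 - t) *: y).
Proof.
split=> [cA x y t t0 t1 Ax Ay|cA x y l]; last first.
  by rewrite !classical_sets.in_setE => Ax Ay; apply: (cA x y l%:num).
by have := cA x y (Itv01 t0 t1); rewrite !classical_sets.in_setE; apply.
Qed.

Lemma conv_hull_sub A : A `<=` conv_hull A.
Proof. exact: sub_gen_smallest. Qed.

Lemma conv_hull_min A B : @convex_set R 'rV[R]_n B -> A `<=` B -> conv_hull A `<=` B.
Proof. exact: smallest_sub. Qed.

Lemma conv_hull_convex A : @convex_set R 'rV[R]_n (conv_hull A).
Proof.
apply/convex_setP => x y t t0 t1 Ax Ay B [cB AB].
by move/convex_setP: (cB); apply=> //; [apply: Ax|apply: Ay].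
Qed.

Lemma conv_hull_comb A x y (t : R) : 0 <= t -> t <= 1 ->
  conv_hull A x -> conv_hull A y -> conv_hull A (t *: x + (1 - t) *: y).
Proof. by move/convex_setP: (conv_hull_convex (A := A)) => h; apply: h. Qed.

Lemma convex_set1 v : @convex_set R 'rV[R]_n [set v].
Proof.
by apply/convex_setP => x y t t0 t1 -> ->; rewrite -scalerDl addrC subrK scale1r.
Qed.

End Hulls.

Section PointConfigurations.
Local Open Scope classical_set_scope.
Local Open Scope ring_scope.
Context {R : realType} {n : nat} {I : finType} (a : I -> 'rV[R]_n).
Implicit Types (x y u v : 'rV[R]_n) (f g : 'cV[R]_(1 + n)) (S T Z C D : {set I}).

Definition lift1 x : 'rV[R]_(1 + n) := row_mx 1%:M x.
Definition pt i := lift1 (a i).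
Definition hull T : set 'rV[R]_n := conv_hull (fun x => exists2 i, i \in T & x = a i).
Definition affv f x : R := (lift1 x *m f) 0 0.

Lemma affvE f x : affv f x = usubmx f 0 0 + (x *m dsubmx f) 0 0.
Proof. by rewrite /affv -{1}(vsubmxK f) mul_row_col mul1mx mxE. Qed.

Lemma affv_comb f x y (t : R) :
  affv f (t *: x + (1 - t) *: y) = t * affv f x + (1 - t) * affv f y.
Proof.
rewrite !affvE mulmxDl -!scalemxAl [X in _ + X = _]mxE [X in _ + (X + _)]mxE.
rewrite [X in _ + (_ + X) = _]mxE; ring.
Qed.

Lemma affv_functional (c : 'cV[R]_n) (b : R) x :
  affv (col_mx b%:M (- c)) x = b - (x *m c) 0 0.
Proof. by rewrite affvE col_mxKu col_mxKd mulmxN !mxE eqxx mulr1n. Qed.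

Lemma hull_in T i : i \in T -> hull T (a i).
Proof. by move=> iT; apply: conv_hull_sub; exists i. Qed.

Lemma hull_min T (B : set 'rV[R]_n) : @convex_set R 'rV[R]_n B ->
  (forall i, i \in T -> B (a i)) -> (hull T `<=` B).
Proof. by move=> cB h; apply: conv_hull_min => // _ [i iT ->]; apply: h. Qed.

Lemma hull_subset S T : S \subset T -> (hull S `<=` hull T).
Proof.
move=> /subsetP ST; apply: hull_min; first exact: conv_hull_convex.
by move=> i /ST; apply: hull_in.
Qed.

Lemma hull0 x : ~ hull set0 x.
Proof.
apply: (@hull_min set0 (fun=> False)); last by move=> i; rewrite inE.
by apply/convex_setP.
Qed.

Lemma hull_neq0 T x : hull T x -> exists i, i \in T.
Proof. by have [->/hull0|[i iT] _] := set_0Vmem T; last exists i. Qed.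

Lemma affv_ge0 T f x : valid pt T f -> hull T x -> 0 <= affv f x.
Proof.
move=> vf; apply: (hull_min (B := fun x => 0 <= affv f x)) => //.
apply/convex_setP => u v t t0 t1 fu fv; rewrite affv_comb.
by apply: addr_ge0; apply: mulr_ge0 => //; rewrite subr_ge0.
Qed.

(** The points with f > 0, together with those of the smaller hull, form a convex
set. This spares any explicit convex combination. *)
Lemma hull_zset T f x : valid pt T f ->
  hull T x /\ affv f x = 0 <-> hull (zset pt T f) x.
Proof.
move=> vf; split=> [[hx fx]|hx]; last first.
  split; first exact: hull_subset (zset_sub _ _ _) _ hx.
  apply: (hull_min (B := fun x => affv f x = 0)) hx.
    apply/convex_setP => u v t t0 t1 fu fv.
    by rewrite affv_comb fu fv !mulr0 addr0.
  by move=> i /zset_ev.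
have : 0 < affv f x \/ affv f x = 0 /\ hull (zset pt T f) x; last first.
  by case=> [|[]//]; rewrite fx ltxx.
apply: (hull_min (B := fun x => 0 < affv f x \/
  affv f x = 0 /\ hull (zset pt T f) x)) hx; last first.
  move=> i iT; have [iZ|iZ] := boolP (i \in zset pt T f).
    by right; split; [apply: zset_ev iZ|apply: hull_in].
  by left; apply: valid_gt0 vf iT iZ.
apply/convex_setP => u v t t0 t1 hu hv.
have [->|tn0] := eqVneq t 0; first by rewrite scale0r add0r subr0 scale1r.
have [->|tn1] := eqVneq t 1; first by rewrite subrr scale0r addr0 scale1r.
have t0' : 0 < t by rewrite lt_neqAle eq_sym tn0.
have t1' : 0 < 1 - t by rewrite subr_gt0 lt_neqAle tn1.
rewrite affv_comb.
case: hu hv => [fu|[fu hu]] [fv|[fv hv]].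
- by left; apply: addr_gt0; apply: mulr_gt0.
- by left; rewrite fv mulr0 addr0 mulr_gt0.
- by left; rewrite fu mulr0 add0r mulr_gt0.
- right; rewrite fu fv !mulr0 addr0; split=> //.
  exact: conv_hull_comb.
Qed.

Lemma is_faceP T F :
  is_face (hull T) F <-> exists2 Z, iface pt T Z & F = hull Z.
Proof.
split=> [[c [b [h ->]]]|[_ [f vf ->] ->]].
  have v : valid pt T (col_mx b%:M (- c)).
    by move=> i iT; rewrite [ev _ _ _]affv_functional subr_ge0; exact: (h _ (hull_in iT)).
  exists (zset pt T (col_mx b%:M (- c))); first by exists (col_mx b%:M (- c)).
  apply/funext => x; apply/propext; rewrite -(hull_zset x v) affv_functional.
  split=> -[hx] /= e; split=> //=; first by rewrite e subrr.
  by apply/esym/eqP; rewrite -subr_eq0 e.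
exists (- dsubmx f), (usubmx f 0 0).
have E x : affv f x = usubmx f 0 0 - (x *m - dsubmx f) 0 0.
  by rewrite affvE mulmxN [X in _ - X]mxE opprK.
split=> [x hx|].
  by rewrite -subr_ge0 -E; apply: affv_ge0 hx.
apply/funext => x; apply/propext; rewrite -(hull_zset x vf) E.
split=> -[hx] /= e; split=> //=; last by rewrite e subrr.
by apply/esym/eqP; rewrite -subr_eq0 e.
Qed.

Lemma hull_mem T Z i : iface pt T Z -> i \in T -> hull Z (a i) -> i \in Z.
Proof. by move=> [f vf ->] iT /(hull_zset _ vf)[_ fi]; apply/zsetP. Qed.

Lemma hull_subP T Z D : iface pt T D -> Z \subset T ->
  (hull Z `<=` hull D) -> Z \subset D.
Proof.
move=> fD /subsetP ZT h; apply/subsetP=> i iZ.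
by apply: (hull_mem fD (ZT i iZ)); exact: (h _ (hull_in iZ)).
Qed.

Lemma hull_inj T Z D : iface pt T Z -> iface pt T D -> hull Z = hull D -> Z = D.
Proof.
move=> fZ fD e; apply/eqP; rewrite eqEsubset.
by rewrite (hull_subP fD (iface_sub fZ)) ?(hull_subP fZ (iface_sub fD)) // e.
Qed.

Lemma iface0 T : iface pt T set0.
Proof.
exists (col_mx 1%:M 0).
  by move=> i _; rewrite [ev _ _ _]affvE col_mxKu col_mxKd mulmx0 !mxE addr0 ler01.
apply/setP=> i; rewrite !inE [ev _ _ _]affvE col_mxKu col_mxKd mulmx0 !mxE addr0.
by rewrite oner_eq0 andbF.
Qed.

Lemma hull_single Z i v : i \in Z -> (forall j, j \in Z -> a j = v) -> hull Z = [set v].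
Proof.
move=> iZ h; apply/funext => x; apply/propext; split=> [|->].
  by apply: hull_min => //; apply: convex_set1.
by rewrite -(h i iZ); apply: hull_in.
Qed.

(** If two points of the face differed in a coordinate, minimizing that coordinate
would cut out a smaller face. *)
Lemma min_face_point T Z i : iface pt T Z -> i \in Z ->
    (forall D j, iface pt T D -> D \subset Z -> j \in D -> D = Z) ->
  hull Z = [set a i].
Proof.
move=> fZ iZ mn; apply: (hull_single iZ) => j jZ.
apply/rowP=> k.
case: (@Order.TotalTheory.arg_minP _ _ I i (mem Z) (fun l => a l 0 k) iZ) => l lZ lmin.
pose f : 'cV[R]_(1 + n) := col_mx (- a l 0 k)%:M (delta_mx k 0).
have fE l' : ev pt f l' = a l' 0 k - a l 0 k.
  rewrite [ev _ _ _]affvE col_mxKu col_mxKd -colE !mxE eqxx mulr1n; ring.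
have E : zset pt Z f = Z.
  apply: (mn _ l); first (apply: iface_trans fZ _; exists f => //).
  - by move=> l' l'Z; rewrite fE subr_ge0; apply: lmin.
  - exact: zset_sub.
  - by apply/zsetP; split=> //; rewrite fE subrr.
have q l' : l' \in Z -> a l' 0 k = a l 0 k.
  by move=> l'Z; apply/eqP; rewrite -subr_eq0 -fE (zset_eqT E).
by rewrite !q.
Qed.

Lemma face_has_vertex T Z i : iface pt T Z -> i \in Z ->
  exists D j, [/\ iface pt T D, D \subset Z, j \in D & hull D = [set a j]].
Proof.
have [k] := ubnP #|Z|; elim: k Z i => // k IH Z i le_k fZ iZ.
have [[D [j [fD DZ jD]]]|none] :=
  pselect (exists D j, [/\ iface pt T D, D \proper Z & j \in D]).
  have [|E [l [fE ED lE hE]]] := IH D j _ fD jD.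
    by have := proper_card DZ; lia.
  by exists E, l; split=> //; apply: subset_trans ED (proper_sub DZ).
exists Z, i; split=> //; apply: (min_face_point fZ) => // D j fD DZ jD.
apply/eqP; rewrite eqEsubset DZ /=; apply/negPn/negP => nZ.
by apply: none; exists D, j; rewrite properE DZ.
Qed.

Lemma lift1_comb k (w : 'I_k -> R) (q : 'I_k -> 'rV[R]_n) : \sum_i w i = 1 ->
  lift1 (\sum_i w i *: q i) = \sum_i w i *: lift1 (q i).
Proof.
move=> w1; apply/rowP=> j; rewrite summxE mxE; case: (splitP j) => l jl.
  transitivity (\sum_i w i); first by rewrite w1 !ord1 mxE eqxx.
  apply: eq_bigr => i _; rewrite mxE.
  rewrite (_ : j = lshift n l); last exact: val_inj.
  by rewrite row_mxEl !ord1 mxE eqxx mulr1.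
rewrite summxE; apply: eq_bigr => i _; rewrite !mxE.
rewrite (_ : j = rshift 1 l); last exact: val_inj.
case: splitP => [o|o /addnI/val_inj ->] //.
by have := ltn_ord o; move=> /[swap] <-; rewrite ltnNge leq_addr.
Qed.

Lemma lift1_inj : injective lift1.
Proof. by move=> x y /eq_row_mx[]. Qed.

Lemma lift1_head x : lift1 x 0 (lshift n 0) = 1.
Proof. by rewrite row_mxEl mxE. Qed.

Lemma lift1_neq0 x : lift1 x != 0.
Proof.
apply/eqP=> /(congr1 (fun y : 'rV_(1 + n) => y 0 (lshift n 0))).
by rewrite /= lift1_head mxE => /eqP; rewrite oner_eq0.
Qed.

Lemma hull_span T x : hull T x -> lift1 x \in ispan pt T.
Proof.
apply: (hull_min (B := fun x => lift1 x \in ispan pt T)); last first.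
  by move=> i iT; apply: ispan_mem.
apply/convex_setP => u v t t0 t1 hu hv.
suff -> : lift1 (t *: u + (1 - t) *: v) = t *: lift1 u + (1 - t) *: lift1 v.
  by apply: memvD; apply: memvZ.
rewrite /lift1 !scale_row_mx add_row_mx; congr row_mx.
by rewrite -scalerDl addrC subrK scale1r.
Qed.

Lemma aff_hullP T x : aff_hull (hull T) x <-> lift1 x \in ispan pt T.
Proof.
split=> [[k [q [w [qT w1 ->]]]]|].
  rewrite lift1_comb //; apply: memv_suml => i _; apply: memvZ.
  exact: hull_span.
rewrite /ispan; move=> /(coord_span (X := in_tuple _)).
set X := in_tuple _; set w := (fun k => coord X k (lift1 x)) => xE.
have Xi (i : 'I_(size [seq pt i | i in T])) : exists2 j, j \in T & X`_i = pt j.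
  have /imageP[j jT e] : X`_i \in [seq pt i | i in T] by apply: mem_nth.
  by exists j.
have w1 : \sum_i w i = 1.
  have := congr1 (fun y : 'rV_(1 + n) => y 0 (lshift n 0)) xE.
  rewrite /= lift1_head => e; rewrite [RHS]e summxE; apply: eq_bigr => i _.
  by have [j _ ->] := Xi i; rewrite mxE lift1_head mulr1.
exists _, (fun i => rsubmx X`_i), w; split=> //.
  by move=> i; have [j jT ->] := Xi i; rewrite row_mxKr; apply: hull_in.
apply: lift1_inj; rewrite lift1_comb // xE; apply: eq_bigr => i _.
by have [j _ ->] := Xi i; rewrite row_mxKr.
Qed.

Lemma hull_aff T x : hull T x -> aff_hull (hull T) x.
Proof. by move=> hx; apply/aff_hullP/hull_span. Qed.

Lemma has_dim_span T k : has_dim (hull T) k -> \dim (ispan pt T) = k.+1.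
Proof.
move=> [x [U [<- UE]]].
pose l := linfun (mulmxr (row_mx 0 1%:M) : 'rV[R]_n -> 'rV[R]_(1 + n)).
have lE u : l u = row_mx 0 u by rewrite lfunE /= mul_mx_row mulmx0 mulmx1.
have l1 u v : lift1 (u + v) = lift1 u + l v.
  by rewrite lE /lift1 add_row_mx addr0.
have xin u : u \in U -> lift1 (x + u) \in ispan pt T.
  by move=> uU; apply/aff_hullP; rewrite UE; exists u.
have x0 : lift1 x \in ispan pt T by rewrite -[x]addr0 xin // mem0v.
have -> : ispan pt T = (l @: U + <[lift1 x]>)%VS.
  apply: subv_anti; apply/andP; split.
    apply: ispan_sub => i iT.
    have : aff_hull (hull T) (a i) by apply: hull_aff; apply: hull_in.
    rewrite UE => -[u uU]; rewrite /pt => <-; rewrite l1 addrC.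
    by apply: memv_add; [apply: memv_img|apply: memv_line].
  rewrite subv_add -memvE x0 andbT; apply/subvP => _ /memv_imgP[u uU ->].
  by rewrite -[l u](addKr (lift1 x)) -l1 addrC memvB // xin.
rewrite dimv_disjoint_sum ?limg_dim_eq ?dim_vline.
- by rewrite lift1_neq0 addn1.
- apply/eqP; rewrite -subv0; apply/subvP => u /memv_capP[_].
  rewrite memv_ker lE memv0 => /eqP e; apply/eqP.
  by have := congr1 rsubmx e; rewrite row_mxKr linear0.
- apply/eqP; rewrite -subv0; apply/subvP => _ /memv_capP[/memv_imgP[u _ ->]].
  case/vlineP=> t; rewrite lE => e.
  have := congr1 (fun y : 'rV_(1 + n) => y 0 (lshift n 0)) e.
  rewrite /= [X in _ = X]mxE lift1_head row_mxEl mxE mulr1 => t0.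
  by rewrite e -t0 scale0r mem0v.
Qed.

Lemma span_has_dim T i k : i \in T -> \dim (ispan pt T) = k.+1 -> has_dim (hull T) k.
Proof.
move=> iT dk.
pose l := linfun (mulmxr (row_mx 0 1%:M) : 'rV[R]_n -> 'rV[R]_(1 + n)).
have lE u : l u = row_mx 0 u by rewrite lfunE /= mul_mx_row mulmx0 mulmx1.
have UE : aff_hull (hull T) = [set a i + u | u in [set` (l @^-1: ispan pt T)%VS]].
  apply/funext => x; apply/propext; rewrite aff_hullP.
  have e u : lift1 (a i + u) = pt i + l u by rewrite lE /pt /lift1 add_row_mx addr0.
  split=> [xT|[u /= uU <-]]; last by rewrite e memvD ?ispan_mem // memv_preim.
  exists (x - a i); last by rewrite addrC subrK.
  rewrite /= -memv_preim -[l _](addKr (pt i)) -e addrC [a i + _]addrC subrK.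
  by rewrite memvB // ispan_mem.
suff <- : \dim (l @^-1: ispan pt T) = k by exists (a i), (l @^-1: ispan pt T)%VS.
have h : has_dim (hull T) (\dim (l @^-1: ispan pt T)).
  by exists (a i), (l @^-1: ispan pt T)%VS.
by have := has_dim_span h; rewrite dk => -[].
Qed.

(** Recognizes an edge from the face order alone: u and v are facets of E. Every
point of E is then s u + t v, and the two facet functionals show that s and t are
nonnegative. *)
Lemma edge_hull E Zu Zv u v : ifacet pt E Zu -> ifacet pt E Zv ->
    hull Zu = [set u] -> hull Zv = [set v] -> u <> v ->
  hull E = conv_hull [set u; v] /\ has_dim (hull E) 1.
Proof.
move=> fu fv hu hv uv.
have [i iu] : exists i, i \in Zu by apply: (@hull_neq0 _ u); rewrite hu.
have [j jv] : exists j, j \in Zv by apply: (@hull_neq0 _ v); rewrite hv.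
have au k : k \in Zu -> a k = u by move/hull_in; rewrite hu.
have av k : k \in Zv -> a k = v by move/hull_in; rewrite hv.
have ju : j \notin Zu by apply/negP => /au; rewrite av // => e; apply: uv.
have iv : i \notin Zv by apply/negP => /av; rewrite au.
have iE : i \in E by case: fu => /iface_sub/subsetP; move/(_ i iu).
have jE : j \in E by case: fv => /iface_sub/subsetP; move/(_ j jv).
have spu : ispan pt Zu = <[pt i]>%VS.
  apply: subv_anti; apply/andP; split; last by rewrite -memvE ispan_mem.
  by apply: ispan_sub => k ku; rewrite /pt au // -(au i iu) memv_line.
split; last first.
  apply: (span_has_dim iE); by rewrite (facet_dim fu) spu dim_vline lift1_neq0.
apply/funext => x; apply/propext; split; last first.
  apply: conv_hull_min; first exact: conv_hull_convex.
  by move=> y [->|->]; [rewrite -(au i iu)|rewrite -(av j jv)]; apply: hull_in.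
apply: hull_min; first exact: conv_hull_convex.
move=> k kE; have [f [vf _] fE] := ifacet_fun fu; have [g [vg _] gE] := ifacet_fun fv.
have : pt k \in ispan pt E by apply: ispan_mem.
rewrite (facet_span fu jE ju) spu => /memv_addP[_ /vlineP[s ->] [_ /vlineP[t ->] kst]].
have ekst h : ev pt h k = s * ev pt h i + t * ev pt h j.
  by rewrite /ev kst mulmxDl -!scalemxAl !mxE.
have t0 : 0 <= t.
  have fj : 0 < ev pt f j by apply: valid_gt0 vf jE _; rewrite -fE.
  have := vf k kE; rewrite ekst (zset_ev (i := i) (p := pt) (T := E)); last by rewrite -fE.
  by rewrite mulr0 add0r pmulr_lge0.
have s0 : 0 <= s.
  have gi : 0 < ev pt g i by apply: valid_gt0 vg iE _; rewrite -gE.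
  have := vg k kE; rewrite ekst (zset_ev (i := j) (p := pt) (T := E)); last by rewrite -gE.
  by rewrite mulr0 addr0 pmulr_lge0.
have st : t = 1 - s.
  have := congr1 (fun y : 'rV_(1 + n) => y 0 (lshift n 0)) kst.
  rewrite /= [in RHS]mxE [X in _ = X + _]mxE [X in _ = _ + X]mxE !lift1_head !mulr1.
  by move=> e; rewrite [X in _ = X - _]e addrAC subrr add0r.
have -> : a k = s *: u + (1 - s) *: v.
  have := congr1 rsubmx kst; rewrite -st linearD !linearZ /= !row_mxKr => ->.
  by rewrite au // av.
have s1 : s <= 1 by rewrite -subr_ge0 -st.
apply: conv_hull_comb s0 s1 _ _; apply: conv_hull_sub; first by left.
by right.
Qed.

End PointConfigurations.

(** * Connectivity of the graph of a cube *)

Section CubeGraph.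
Context {k : nat}.
Local Notation V := {ffun 'I_k -> bool}.
Implicit Types (x y z u b : V) (i j : 'I_k) (J S : {set 'I_k}) (X W K : {set V}).

Definition flip i x : V := [ffun j => if j == i then ~~ x j else x j].

Definition within W : rel V :=
  connect [rel x y | [&& x \in W, y \in W & [exists i, y == flip i x]]].

Definition subcube J u := [set x : V | [forall i, (i \notin J) ==> (x i == u i)]].
Definition pattern S b := [set x : V | [forall i, (i \in S) ==> (x i == b i)]].

Lemma subcubeP J u x : reflect (forall i, i \notin J -> x i = u i) (x \in subcube J u).
Proof.
rewrite inE; apply: (iffP forallP) => h i.
  by move=> iJ; have := h i; rewrite iJ => /eqP.
by apply/implyP => iJ; rewrite h.
Qed.

Lemma patternP S b x : reflect (forall i, i \in S -> x i = b i) (x \in pattern S b).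
Proof.
rewrite inE; apply: (iffP forallP) => h i.
  by move=> iJ; have := h i; rewrite iJ => /eqP.
by apply/implyP => iJ; rewrite h.
Qed.

Lemma flip_at i x : flip i x i = ~~ x i.
Proof. by rewrite ffunE eqxx. Qed.

Lemma flip_off i j x : j != i -> flip i x j = x j.
Proof. by rewrite ffunE => /negbTE->. Qed.

Lemma flipK i : involutive (flip i).
Proof.
move=> x; apply/ffunP=> j; have [->|ji] := eqVneq j i; first by rewrite !flip_at negbK.
by rewrite !flip_off.
Qed.

Lemma within_sub W W' x y : W \subset W' -> within W x y -> within W' x y.
Proof.
move=> /subsetP sW; apply: connect_sub => u v /and3P[/sW uW /sW vW e].
by apply: connect1; apply/and3P.
Qed.

Lemma within_flip W i x : x \in W -> flip i x \in W -> within W x (flip i x).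
Proof.
by move=> xW fW; apply: connect1; rewrite /= xW fW; apply/existsP; exists i.
Qed.

Lemma card_subcube J u : (2 ^ #|J| <= #|subcube J u|)%N.
Proof.
pose m (A : {set 'I_k}) : V := [ffun i => if i \in A then ~~ u i else u i].
have mi : {in powerset J &, injective m}.
  move=> A B _ _ /ffunP e; apply/setP=> i; have := e i; rewrite !ffunE.
  by case: (i \in A); case: (i \in B); case: (u i).
rewrite -card_powerset -(card_in_imset mi); apply/subset_leq_card/subsetP.
move=> _ /imsetP[A AJ ->]; apply/subcubeP => i iJ; rewrite ffunE ifN //.
by apply: contra iJ; apply/subsetP; rewrite -powersetE.
Qed.

Lemma subcube_free J u X : (#|X| < 2 ^ #|J|)%N -> exists2 z, z \in subcube J u & z \notin X.
Proof.
move=> lt; apply/subsetPn; apply: contraL lt => /subset_leq_card.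
by rewrite -leqNgt; apply: leq_trans; apply: card_subcube.
Qed.

(** There are as many edges in direction i as elements of the half cube, and a
vertex of X spoils only one of them. *)
Lemma subcube_edge_free i J u X : i \notin J -> (#|X| < 2 ^ #|J|)%N ->
  exists z, [/\ z \in subcube J u, z \notin X & flip i z \notin X].
Proof.
move=> iJ lt; pose m (w : V) := if w i == u i then w else flip i w.
have [|z zJ zX] := @subcube_free J u (m @: X).
  exact: leq_ltn_trans (leq_imset_card _ _) lt.
have zi : z i = u i by apply: (subcubeP _ _ _ zJ).
exists z; split=> //; apply: contra zX => zX; apply/imsetP.
  by exists z => //; rewrite /m zi eqxx.
by exists (flip i z) => //; rewrite /m flip_at zi; case: (u i); rewrite /= flipK.
Qed.

(** The m-dimensional cube is m-connected. Cut it in two halves along a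
direction. If X meets both halves, each of them stays connected by induction; if X
lies in one half, detours through the other, intact, half are available. *)
Lemma subcube_connected J u X x y : (#|X| < #|J|)%N ->
    x \in subcube J u :\: X -> y \in subcube J u :\: X ->
  within (subcube J u :\: X) x y.
Proof.
have [k0] := ubnP #|J|; elim: k0 J u X x y => // k0 IH J u X x y le_k lt.
have [i iJ] : exists i, i \in J.
  by apply/set0Pn; rewrite -card_gt0; apply: leq_ltn_trans lt.
pose J' := J :\ i; have cJ : #|J| = #|J'|.+1 by rewrite (cardsD1 i) iJ.
have iJ' : i \notin J' by rewrite !inE eqxx.
set W := subcube J u :\: X.
have half v w : v \in subcube J u -> w \in subcube J' v -> w \in subcube J u.
  move=> /subcubeP vu /subcubeP wv; apply/subcubeP=> j jJ.
  by rewrite wv ?vu // !inE negb_and jJ orbT.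
have halfS v : v \in subcube J u -> forall X' : {set V}, X :&: subcube J' v \subset X' ->
    subcube J' v :\: X' \subset W.
  move=> vu X' /subsetP sX; apply/subsetP=> w /setDP[wv wX]; rewrite inE (half v) // andbT.
  by apply: contra wX => wX; apply: sX; rewrite inE wX.
have flipu v : v \in subcube J u -> flip i v \in subcube J u.
  move=> /subcubeP vu; apply/subcubeP=> j jJ; rewrite flip_off ?vu //.
  by apply: contraNneq jJ => ->.
have same v w : v \in W -> w \in W -> v i = w i -> within W v w.
  move=> vW wW vw; have [vu vX] := setDP vW; have [wu wX] := setDP wW.
  have wv : w \in subcube J' v.
    apply/subcubeP=> j jJ'; have [->//|ji] := eqVneq j i.
    have jJ : j \notin J by move: jJ'; rewrite !inE ji.
    by move/subcubeP: vu => ->//; move/subcubeP: wu => ->.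
  have vv : v \in subcube J' v by apply/subcubeP.
  have [small|big] := ltnP #|X :&: subcube J' v| #|J'|.
    apply: within_sub (halfS v vu _ (subxx _)) _; apply: IH => //.
    - by rewrite -ltnS -cJ.
    - by rewrite in_setD in_setI (negbTE vX).
    - by rewrite in_setD in_setI (negbTE wX).
  have [e|J'0] := posnP #|J'|.
    have wvE : w = v.
      by move/cards0_eq: e => e; apply/ffunP=> j; rewrite (subcubeP _ _ _ wv) // e inE.
    by rewrite wvE; apply: connect0.
  (* All of X lies in the half containing v and w; the other half is intact. *)
  have Xv : X \subset subcube J' v.
    have /eqP <- : X :&: subcube J' v == X; last exact: subsetIr.
    by rewrite eqEcard subsetIl /= (leq_trans _ big) // -ltnS -cJ.
  have fu := flipu v vu.
  have fX z : z \in subcube J' (flip i v) -> z \notin X.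
    move=> /subcubeP zv; apply/negP => /(subsetP Xv)/subcubeP zv'.
    by have := zv' i iJ'; rewrite zv // flip_at; case: (v i).
  have fwv : flip i w \in subcube J' (flip i v).
    apply/subcubeP=> j jJ'; move/subcubeP: wv => wv; rewrite !ffunE.
    by case: eqP => _; rewrite wv.
  have fvv : flip i v \in subcube J' (flip i v) by apply/subcubeP.
  have fvW : flip i v \in W by rewrite in_setD fX // fu.
  have fwW : flip i w \in W by rewrite in_setD fX // flipu.
  apply: connect_trans (within_flip (i := i) vW fvW) _.
  have fw : within W (flip i w) w.
    by rewrite -{2}(flipK i w); apply: within_flip; rewrite ?flipK.
  apply: connect_trans fw.
  apply: (@within_sub (subcube J' (flip i v) :\: set0)).
    apply: halfS => //; apply/subsetP=> z /setIP[zX /fX]; by rewrite zX.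
  by apply: IH; rewrite ?setD0 ?cards0 // -ltnS -cJ.
move=> xW yW; have [xy|xy] := eqVneq (x i) (y i); first exact: same.
have [xu xX] := setDP xW.
have [|z [zx zX fzX]] := @subcube_edge_free i J' x X iJ'.
  by rewrite cJ ltnS in lt; apply: leq_ltn_trans lt (ltn_expl _ _).
have zW : z \in W by rewrite in_setD zX (half x).
have fzW : flip i z \in W by rewrite in_setD fzX flipu // (half x).
have zi : z i = x i by move/subcubeP: zx; apply.
apply: connect_trans (same x z xW zW (esym zi)) _.
apply: connect_trans (within_flip zW fzW) _; apply: same => //.
by rewrite flip_at zi; move: xy; case: (x i); case: (y i).
Qed.

Lemma card_coset1 i : #|~: [set i]| = k.-1.
Proof. by rewrite cardsC1 card_ord. Qed.

Lemma card_coset2 i j : (k - 2 <= #|~: [set i; j]|)%N.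
Proof. by rewrite cardsCs setCK card_ord leq_sub2l // cards2; case: (i != j). Qed.

(** The facets of the cube opposite to those containing K stay connected when X is
removed, being (k - 1)-cubes, and two of them meet in 2 ^ (k - 2) vertices, more than
X has. *)
Lemma cube_minus_connected K X x y :
    (K = set0 \/ exists S b, K = pattern S b) -> (#|X| <= k - 2)%N -> (2 <= k)%N ->
    x \in ~: (K :|: X) -> y \in ~: (K :|: X) ->
  within (~: (K :|: X)) x y.
Proof.
move=> KE leX k2 xW yW; have ltX : (#|X| < k.-1)%N by lia.
have expX (J : {set 'I_k}) : (k - 2 <= #|J|)%N -> (#|X| < 2 ^ #|J|)%N.
  by move=> h; apply: leq_ltn_trans (leq_trans leX h) (ltn_expl _ _).
have [xK xX] : x \notin K /\ x \notin X by apply/andP; rewrite -negb_or -in_setU -in_setC.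
have [yK yX] : y \notin K /\ y \notin X by apply/andP; rewrite -negb_or -in_setU -in_setC.
case: KE => [K0|[S [b KE]]].
  have cT z : z \in subcube setT x by apply/subcubeP => i; rewrite inE.
  apply: (@within_sub (subcube setT x :\: X)).
    by apply/subsetP=> z /setDP[_ zX]; rewrite K0 set0U inE.
  by apply: subcube_connected; rewrite ?in_setD ?xX ?yX ?cT // cardsT card_ord; lia.
(* The complement of the face is the union of the facets x_i = ~~ b_i. *)
have wit z : z \notin K -> exists2 i, i \in S & z i != b i.
  rewrite KE inE negb_forall => /existsP[i]; rewrite negb_imply => /andP[iS ne].
  by exists i.
have side i z : i \in S -> z i != b i -> forall w, w \in subcube (~: [set i]) z :\: X ->
    within (~: (K :|: X)) z w \/ z \in X.
  move=> iS zi w wz; have [zX|zX] := boolP (z \in X); first by right.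
  left; apply: (@within_sub (subcube (~: [set i]) z :\: X)).
    apply/subsetP=> v /setDP[/subcubeP vz vX]; rewrite !inE negb_or vX andbT KE.
    by apply: contra zi => /patternP/(_ i iS) <-; rewrite vz // !inE eqxx.
  apply: subcube_connected => //; first by rewrite card_coset1.
  by rewrite in_setD zX; apply/subcubeP.
have sideC i z w : i \in S -> z i != b i -> z \notin X -> w \notin X -> w i = z i ->
    within (~: (K :|: X)) z w.
  move=> iS zi zX wX wz; case: (side i z iS zi w) => //; last by rewrite (negbTE zX).
  by rewrite in_setD wX; apply/subcubeP=> j; rewrite !inE negbK => /eqP->.
have [i iS xi] := wit x xK; have [j jS yj] := wit y yK.
have [ij|ij] := eqVneq i j.
  by apply: (sideC i) => //; move: xi yj; rewrite -ij; case: (x i) (y i) (b i) => [] [] [].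
pose w : V := [ffun l => if l == i then x i else y l].
have [|z /subcubeP zw zX] := @subcube_free (~: [set i; j]) w X.
  by apply: expX; apply: card_coset2.
have zi : z i = x i by rewrite zw ?ffunE ?eqxx // !inE eqxx.
have zj : z j = y j by rewrite zw ?ffunE ?[j == i]eq_sym ?(negbTE ij) // !inE eqxx orbT.
apply: connect_trans (sideC i x z iS xi xX zX zi) _.
by apply: (sideC j) => //; rewrite zj.
Qed.

End CubeGraph.

(** * The faces of the standard cube *)

Section PatternOrder.
Context {k : nat}.
Implicit Types (S : {set 'I_k}) (b x : {ffun 'I_k -> bool}).

Lemma pattern_base S b : b \in pattern S b.
Proof. exact/patternP. Qed.

Lemma pattern_sub S b S' b' : pattern S b \subset pattern S' b' ->
  S' \subset S /\ forall i, i \in S' -> b i = b' i.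
Proof.
move=> /subsetP h; have /patternP bb := h b (pattern_base S b); split=> //.
apply/subsetP=> i iS'; apply/negPn/negP => iS.
have /h/patternP/(_ i iS') : flip i b \in pattern S b.
  by apply/patternP => j jS; rewrite flip_off //; apply: contraNneq iS => <-.
by rewrite flip_at bb //; case: (b' i).
Qed.

End PatternOrder.

Section StandardCube.
Local Open Scope classical_set_scope.
Local Open Scope ring_scope.
Context {R : realType} {k : nat}.
Local Notation V := {ffun 'I_k -> bool}.
Implicit Types (x b : V) (S : {set 'I_k}) (r : 'rV[R]_k) (G : set 'rV[R]_k).

Definition corner x : 'rV[R]_k := \row_i (x i)%:R.

Definition subbox S b : set 'rV[R]_k :=
  fun r => std_cube r /\ forall i, i \in S -> r 0 i = (b i)%:R.

Lemma boolR_inj (c c' : bool) : c%:R = c'%:R :> R -> c = c'.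
Proof. by move/eqP; rewrite eqr_nat; case: c c' => [] []. Qed.

Lemma corner_inj : injective corner.
Proof. by move=> x y /rowP e; apply/ffunP=> i; have := e i; rewrite !mxE => /boolR_inj. Qed.

Lemma corner_cube x : std_cube (corner x).
Proof. by move=> i; rewrite mxE; case: (x i); rewrite ?lexx ler01. Qed.

Lemma corner_subbox S b x : subbox S b (corner x) <-> x \in pattern S b.
Proof.
split=> [[_ h]|/patternP h]; first by apply/patternP=> i /h; rewrite mxE => /boolR_inj.
by split=> [|i /h]; [apply: corner_cube|rewrite mxE => ->].
Qed.

(** A linear functional is maximized on the cube coordinate by coordinate. *)
Lemma cube_max (c : 'cV[R]_k) S b r :
    (forall i, i \in S = (c i 0 != 0)) -> (forall i, i \in S -> b i = (0 < c i 0)) ->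
    std_cube r ->
  (r *m c) 0 0 <= (corner b *m c) 0 0 /\
  ((r *m c) 0 0 = (corner b *m c) 0 0 <-> forall i, i \in S -> r 0 i = (b i)%:R).
Proof.
move=> cS cb rc; pose t i := ((b i)%:R - r 0 i) * c i 0.
have t0 i : 0 <= t i.
  have /andP[r0 r1] := rc i; rewrite /t.
  have [iS|] := boolP (i \in S); last by rewrite cS negbK => /eqP->; rewrite mulr0.
  rewrite cb //; case: ltP => [c0|c0]; first by rewrite mulr_ge0 ?subr_ge0 // ltW.
  by rewrite sub0r mulNr -mulrN mulr_ge0 // oppr_ge0.
have E : (corner b *m c) 0 0 - (r *m c) 0 0 = \sum_i t i.
  by rewrite !mxE -sumrB; apply: eq_bigr => i _; rewrite mxE /t mulrBl.
split; first by rewrite -subr_ge0 E sumr_ge0.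
split=> [e i iS|h].
  have s0 : \sum_i t i = 0 by rewrite -E e subrr.
  have z := psumr_eq0P (P := xpredT) (fun j _ => t0 j) s0.
  have /eqP : t i = 0 by apply: z.
  by rewrite /t mulf_eq0 subr_eq0 -[c i 0 == 0]negbK -cS iS orbF => /eqP.
apply/esym/eqP; rewrite -subr_eq0 E; apply/eqP/big1 => i _; rewrite /t.
have [iS|] := boolP (i \in S); first by rewrite h // subrr mul0r.
by rewrite cS negbK => /eqP->; rewrite mulr0.
Qed.

Lemma cube_faceP G : is_face (@std_cube R k) G ->
  G = classical_sets.set0 \/ exists S b, G = subbox S b.
Proof.
move=> [c [m [le ->]]].
pose S := [set i | c i 0 != 0]%SET; pose b : V := [ffun i => 0 < c i 0].
have mx r : std_cube r -> _ := cube_max (S := S) (b := b)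
  (fun i => in_set _ i) (fun i _ => ffunE _ i).
have lem := le _ (corner_cube b).
have [e|ne] := eqVneq ((corner b *m c) 0 0) m.
  right; exists S, b; apply/funext => r; apply/propext; split=> -[rc h]; split=> //.
    by apply/(proj2 (mx r rc)); rewrite e.
  by rewrite /= -e; apply/(proj2 (mx r rc)).
left; apply/funext => r; apply/propext; split=> // -[rc /= h].
have [] := mx r rc; rewrite h => lm _.
by move: ne; rewrite eq_le lem lm.
Qed.

Lemma subbox_is_face S b : is_face (@std_cube R k) (subbox S b).
Proof.
pose c : 'cV[R]_k := \col_i (if i \in S then (if b i then 1 else -1) else 0).
have cS i : (i \in S) = (c i 0 != 0).
  rewrite mxE; case: (i \in S); rewrite ?eqxx //.
  by case: (b i); rewrite ?oppr_eq0 oner_eq0.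
have cb i : i \in S -> b i = (0 < c i 0).
  by move=> iS; rewrite mxE iS; case: (b i); rewrite ?ltr01 // oppr_gt0 ltr10.
exists c, ((corner b *m c) 0 0); split=> [r rc|]; first by have [] := cube_max cS cb rc.
apply/funext => r; apply/propext; split=> -[rc h]; split=> //.
  by apply/(proj2 (cube_max cS cb rc)).
by apply/(proj2 (cube_max cS cb rc)).
Qed.

Lemma cube_face0 : is_face (@std_cube R k) classical_sets.set0.
Proof.
exists 0, 1; split=> [r _|]; first by rewrite mulmx0 mxE ler01.
apply/funext => r; apply/propext; split=> // -[_ /=]; rewrite mulmx0 mxE => /eqP.
by rewrite eq_sym oner_eq0.
Qed.

Lemma subbox_setT x : subbox setT x = [set corner x].
Proof.
apply/funext => r; apply/propext; split=> [[_ h]|->]; last exact/corner_subbox/pattern_base.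
by apply/rowP=> i; rewrite mxE h.
Qed.

Lemma subbox_subset S b S' b' : pattern S b \subset pattern S' b' ->
  subbox S b `<=` subbox S' b'.
Proof.
move=> /pattern_sub[/subsetP SS bb] r [rc h]; split=> // i iS.
by rewrite h ?bb //; apply: SS.
Qed.

End StandardCube.

(** * Polytopes combinatorially equivalent to a cube *)

Section CubeLabelling.
Local Open Scope classical_set_scope.
Local Open Scope ring_scope.
Context {R : realType} {n : nat} {I : finType} (a : I -> 'rV[R]_n).
Implicit Types (T Z D E : {set I}) (v : 'rV[R]_n).

Local Notation hull := (hull a).
Local Notation pt := (pt a).

Definition labels k (psi : {ffun 'I_k -> bool} -> 'rV[R]_n) Z :=
  [set x | `[< hull Z (psi x) >]]%SET.

(** The only information that is kept from the order isomorphism of face lattices. *)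
Record cube_labelling T k (psi : {ffun 'I_k -> bool} -> 'rV[R]_n) : Prop := CubeLabelling {
  label_inj : injective psi;
  label_vertex : forall v, is_face (hull T) [set v] <-> exists x, v = psi x;
  label_face : forall Z, iface pt T Z ->
    labels psi Z = set0 \/ exists S b, labels psi Z = pattern S b;
  face_label : forall S b, exists2 Z, iface pt T Z & labels psi Z = pattern S b;
  label_sub : forall Z D, iface pt T Z -> iface pt T D ->
    labels psi Z \subset labels psi D -> Z \subset D }.

Lemma labelsP k (psi : {ffun 'I_k -> bool} -> 'rV[R]_n) Z x :
  reflect (hull Z (psi x)) (x \in labels psi Z).
Proof. by rewrite inE; apply: asboolP. Qed.

Lemma labels_subset k (psi : {ffun 'I_k -> bool} -> 'rV[R]_n) Z D :
  Z \subset D -> labels psi Z \subset labels psi D.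
Proof.
by move=> ZD; apply/subsetP=> x /labelsP xZ; apply/labelsP; apply: hull_subset ZD _ xZ.
Qed.

(** The face matched with a corner of the cube is minimal among the nonempty
faces, hence a single point, which gets the name of that corner. *)
Lemma cube_labelling_exists T k : comb_equiv (hull T) (@std_cube R k) ->
  exists psi : {ffun 'I_k -> bool} -> 'rV[R]_n, cube_labelling T psi.
Proof.
move=> [phi [[phiF phiI phiS] phiO]].
pose P Z := phi (hull Z).
have PF Z : iface pt T Z -> is_face (@std_cube R k) (P Z).
  by move=> fZ; apply: phiF; apply/is_faceP; exists Z.
have PS G : is_face (@std_cube R k) G -> exists2 Z, iface pt T Z & P Z = G.
  by case/phiS => F /is_faceP[Z fZ ->] <-; exists Z.
have PO Z D : iface pt T Z -> iface pt T D -> (P Z `<=` P D) <-> Z \subset D.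
  move=> fZ fD; rewrite -phiO; [|by apply/is_faceP; exists Z|by apply/is_faceP; exists D].
  by split; [exact: hull_subP fD (iface_sub fZ)|exact: hull_subset].
have PI Z D : iface pt T Z -> iface pt T D -> P Z = P D -> Z = D.
  move=> fZ fD e; apply/eqP; rewrite eqEsubset.
  by apply/andP; split; [apply/(PO _ _ fZ fD)|apply/(PO _ _ fD fZ)]; rewrite e.
have P0 : P set0 = classical_sets.set0.
  have [Z fZ e] := PS _ cube_face0; rewrite -classical_sets.subset0 -e.
  by apply/PO; rewrite ?sub0set //; apply: iface0.
have Pn0 Z : iface pt T Z -> P Z = classical_sets.set0 -> Z = set0.
  by move=> fZ e; apply: PI => //; [apply: iface0|rewrite P0].
have ex x : exists v, exists Z, [/\ iface pt T Z, P Z = [set corner x] & hull Z = [set v]].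
  have [Z fZ ZE] : exists2 Z, iface pt T Z & P Z = [set corner x].
    by apply: PS; rewrite -subbox_setT; apply: subbox_is_face.
  have [Z0|[i iZ]] := set_0Vmem Z.
    by have : P Z (corner x); [rewrite ZE|rewrite Z0 P0].
  exists (a i), Z; split=> //; apply: (min_face_point fZ iZ) => D j fD DZ jD.
  apply: PI => //; rewrite ZE.
  have sub : P D `<=` [set corner x] by rewrite -ZE; apply/PO.
  have [/Pn0 D0|] := pselect (P D = classical_sets.set0); first by rewrite D0 // inE in jD.
  move/eqP/set0P=> [r Dr]; apply/seteqP; split=> // s ->.
  by rewrite -(sub r Dr).
have [psi psiP] := choice ex.
have mem Z x : iface pt T Z -> hull Z (psi x) <-> P Z (corner x).
  move=> fZ; have [D [fD DE De]] := psiP x.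
  have h : hull D `<=` hull Z <-> P D `<=` P Z.
    rewrite PO //; split; [exact: hull_subP fZ (iface_sub fD)|exact: hull_subset].
  move: h; rewrite De DE => h; split=> hx.
    by apply: (proj1 h) => // y ->.
  by apply: (proj2 h) => // y ->.
have labE Z : iface pt T Z ->
    labels psi Z = set0 :> {set _} /\ P Z = classical_sets.set0 \/
    exists S b, labels psi Z = pattern S b /\ P Z = subbox S b.
  move=> fZ; have [e|[S [b e]]] := cube_faceP (PF _ fZ); [left|right].
    split=> //; apply/setP=> x; rewrite in_set0; apply/negP=> /labelsP/(mem _ _ fZ).
    by rewrite e.
  exists S, b; split=> //; apply/setP=> x; apply/idP/idP.
    by move/labelsP/(mem _ _ fZ); rewrite e => /corner_subbox.
  by move=> /(@corner_subbox R) xS; apply/labelsP/(mem _ _ fZ); rewrite e.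
exists psi; split.
- move=> x y e; have [Z [fZ ZE hZ]] := psiP x; have [D [fD DE hD]] := psiP y.
  have ZD : Z = D by apply: hull_inj fZ fD _; rewrite hZ hD e.
  have : P Z (corner x) by rewrite ZE.
  by rewrite ZD DE => /corner_inj.
- move=> v; split=> [/is_faceP[Z fZ ZE]|[x ->]]; last first.
    by have [Z [fZ _ <-]] := psiP x; apply/is_faceP; exists Z.
  have [[l0 PZ]|[S [b [lE _]]]] := labE Z fZ.
    have : hull Z v by rewrite -ZE.
    by rewrite (Pn0 _ fZ PZ) => /hull0.
  exists b; have /labelsP : b \in labels psi Z by rewrite lE pattern_base.
  by rewrite -ZE.
- by move=> Z /labE[[-> _]|[S [b [-> _]]]]; [left|right; exists S, b].
- move=> S b; have [Z fZ ZE] := PS _ (subbox_is_face S b); exists Z => //.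
  by apply/setP=> x; apply/labelsP/idP; rewrite mem // ZE => /corner_subbox.
- move=> Z D fZ fD sub; apply/(PO _ _ fZ fD).
  have [[_ ->]//|[S [b [e ->]]]] := labE Z fZ.
  have [[e' _]|[S' [b' [e' ->]]]] := labE D fD.
    by move: sub; rewrite e e' => /subsetP/(_ b (pattern_base _ _)); rewrite inE.
  by apply: subbox_subset; rewrite -e -e'.
Qed.

Section Labelled.
Context {T : {set I}} {k : nat} {psi : {ffun 'I_k -> bool} -> 'rV[R]_n}.
Hypothesis L : cube_labelling T psi.

Lemma label_eq Z D : iface pt T Z -> iface pt T D -> labels psi Z = labels psi D -> Z = D.
Proof.
by move=> fZ fD e; apply/eqP; rewrite eqEsubset !(label_sub L) // e.
Qed.

Lemma labels_full x : x \in labels psi T.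
Proof.
apply/labelsP; have /(label_vertex L) : exists y, psi x = psi y by exists x.
by move=> [c [b [_ e]]]; have : [set psi x] (psi x) by []; rewrite e => -[].
Qed.

Lemma label_index x : exists2 i, i \in T & psi x = a i.
Proof.
have /(label_vertex L)/is_faceP[Z fZ e] : exists y, psi x = psi y by exists x.
have [i iZ] : exists i, i \in Z by apply: (@hull_neq0 _ _ _ a _ (psi x)); rewrite -e.
exists i; first by apply: (subsetP (iface_sub fZ)).
by have := hull_in (a := a) iZ; rewrite -e.
Qed.

Lemma label_point x : exists Z,
  [/\ iface pt T Z, hull Z = [set psi x] & labels psi Z = [set x]%SET].
Proof.
have /(label_vertex L)/is_faceP[Z fZ e] : exists y, psi x = psi y by exists x.
exists Z; split=> //; apply/setP=> y; rewrite inE; apply/labelsP/eqP; rewrite -e.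
  by move/(label_inj L).
by move=> ->.
Qed.

(** The face labelled by x and its i-th neighbour has just these two vertices as
proper nonempty faces, so that both are facets of it. *)
Lemma label_edge x i : polytope_adj (hull T) (psi x) (psi (flip i x)).
Proof.
have ne : x != flip i x by apply/eqP=> /ffunP/(_ i); rewrite flip_at; case: (x i).
have [Zu [fu hu lu]] := label_point x; have [Zv [fv hv lv]] := label_point (flip i x).
have [E fE lE] := face_label L (~: [set i])%SET x.
have memE y : (y \in labels psi E) = (y == x) || (y == flip i x).
  rewrite lE; apply/patternP/orP => [h|[/eqP->//|/eqP-> j]]; last first.
    by rewrite !inE => ji; rewrite flip_off.
  have off j : j != i -> y j = x j by move=> ji; apply: h; rewrite !inE.
  have [yi|yi] := eqVneq (y i) (x i); [left|right]; apply/eqP/ffunP=> j.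
    by have [->|/off] := eqVneq j i.
  have [->|ji] := eqVneq j i; last by rewrite flip_off // off.
  by rewrite flip_at; move: yi; case: (y i) (x i) => [] [].
have facet z Z w : iface pt T Z -> labels psi Z = [set z]%SET -> z \in labels psi E ->
    (forall y, (y \in labels psi E) -> (y == z) || (y == w)) -> w \in labels psi E ->
    z != w -> ifacet pt E Z.
  move=> fZ lZ zE zw wE znw.
  have ZE : Z \subset E by apply: (label_sub L) => //; rewrite lZ sub1set.
  split.
  - by have := iface_restrict (iface_sub fE) fZ; rewrite (setIidPl ZE).
  - apply/eqP=> e; move: wE; rewrite -e lZ inE => /eqP e'.
    by rewrite e' eqxx in znw.
  - move=> D fD ZD DE; have fDT := iface_trans fE fD.
    apply: label_eq => //; apply/eqP; rewrite eqEsubset; apply/andP; split; last first.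
      exact: labels_subset.
    rewrite lZ; apply/subsetP=> y yD; rewrite inE.
    have yE : y \in labels psi E by apply: (subsetP (labels_subset psi (iface_sub fD))).
    case/orP: (zw y yE) => // /eqP yw; case/negP: DE; rewrite eqEsubset (iface_sub fD) /=.
    apply: (label_sub L) => //.
    apply/subsetP=> y' /zw/orP[/eqP->|/eqP->]; last by rewrite -yw.
    by apply: (subsetP (labels_subset psi ZD)); rewrite lZ inE.
have uv : psi x <> psi (flip i x) by move/(label_inj L)/eqP; apply/negP.
have Zuf : ifacet pt E Zu.
  by apply: (facet x Zu (flip i x)); rewrite // ?memE ?eqxx ?orbT // => y; rewrite memE.
have Zvf : ifacet pt E Zv.
  apply: (facet (flip i x) Zv x); rewrite // ?memE ?eqxx ?orbT //; last by rewrite eq_sym.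
  by move=> y; rewrite memE orbC.
have [hE dE] := edge_hull Zuf Zvf hu hv uv.
split=> //; first by apply/(label_vertex L); exists x.
  by apply/(label_vertex L); exists (flip i x).
by rewrite -hE; split=> //; apply/is_faceP; exists E.
Qed.

Lemma label_empty Z : iface pt T Z -> labels psi Z = set0 -> Z = set0.
Proof.
move=> fZ e; apply/eqP; rewrite -subset0; apply: (label_sub L) => //.
  exact: iface0.
by rewrite e sub0set.
Qed.

(** Passing to a facet lowers the dimension by exactly one and, on the cube side,
fixes at least one more coordinate. *)
Lemma dim_label_face Z S b : iface pt T Z -> labels psi Z = pattern S b ->
  (\dim (ispan pt Z) <= (k - #|S|).+1)%N.
Proof.
have [m] := ubnP #|Z|; elim: m Z S b => // m IH Z S b le_m fZ lZ.
have Z0 : set0 != Z.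
  apply/eqP=> e; have /labelsP : b \in labels psi Z by rewrite lZ pattern_base.
  by rewrite -e => /hull0.
have [D fD _] := sub_ifacet (iface0 a Z) Z0.
have [fDZ DZ _] := fD; have fDT := iface_trans fZ fDZ; have sDZ := iface_sub fDZ.
rewrite (facet_dim fD) ltnS; have [lD|[S' [b' lD]]] := label_face L fDT.
  rewrite (label_empty fDT lD) (_ : ispan pt set0 = 0%VS) ?dimv0 //.
  apply/eqP; rewrite -subv0; apply: ispan_sub => i; by rewrite inE.
have := labels_subset psi sDZ; rewrite lD lZ => /pattern_sub[SS bb].
have pr : S \proper S'.
  rewrite properE SS /=; apply: contra DZ => SS'; apply/eqP/label_eq => //.
  rewrite lD lZ; apply/setP=> x; apply/patternP/patternP => h i iS.
    by rewrite h ?bb // (subsetP SS).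
  by have iS' := subsetP SS' i iS; rewrite h ?bb.
have cS := proper_card pr.
have cS' : (#|S'| <= k)%N by rewrite -[leqRHS]card_ord max_card.
have /proper_card DZc : D \proper Z by rewrite properEneq DZ sDZ.
have cD : (#|D| < m)%N by lia.
have := IH D S' b' cD fDT lD; lia.
Qed.

Lemma labels_setT Z : iface pt T Z -> labels psi Z = setT -> Z = T.
Proof.
move=> fZ e; apply: label_eq => //; first exact: iface_refl.
by rewrite e; apply/setP=> x; rewrite labels_full inE.
Qed.

Lemma dim_label : (\dim (ispan pt T) <= k.+1)%N.
Proof.
have := @dim_label_face T set0 [ffun=> false] (iface_refl _ _).
rewrite cards0 subn0; apply; apply/setP=> x; rewrite labels_full.
by apply/esym/patternP => i; rewrite inE.
Qed.

(** A facet is a maximal proper subcube, so it fixes a single coordinate. *)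
Lemma label_facet B : ifacet pt T B -> (1 < \dim (ispan pt T))%N ->
  exists i b, labels psi B = pattern [set i]%SET b.
Proof.
move=> fB dT; have [iB BT mx] := fB; have [l0|[S [b lB]]] := label_face L iB.
  move: dT; rewrite (facet_dim fB) (label_empty iB l0) (_ : ispan pt set0 = 0%VS) ?dimv0 //.
  apply/eqP; rewrite -subv0; apply: ispan_sub => i; by rewrite inE.
have [i iS] : exists i, i \in S.
  apply/set0Pn; apply: contraNneq BT => S0; apply/eqP/labels_setT => //.
  by rewrite lB S0; apply/setP=> x; rewrite in_setT; apply/patternP => j; rewrite inE.
exists i, b; have [G fG lG] := face_label L [set i]%SET b.
rewrite -lG; congr labels; apply/esym/mx => //.
  apply: (label_sub L) => //; rewrite lB lG; apply/subsetP=> x /patternP h.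
  by apply/patternP=> j; rewrite inE => /eqP->; apply: h.
apply/eqP=> GT; have := labels_full (flip i b); rewrite -GT lG => /patternP/(_ i).
by rewrite inE eqxx flip_at => /(_ isT); case: (b i).
Qed.

End Labelled.
End CubeLabelling.

(** * Removing a face and a few vertices *)

Section GraphConnectivity.
Local Open Scope classical_set_scope.
Local Open Scope ring_scope.
Context {T : Type} (G : graph T).

Definition gwalk (u v : T) : Prop :=
  exists s : seq T, path (fun x y => `[< gadj G x y >]) u s /\ last u s = v.

Lemma gwalk_refl u : gwalk u u.
Proof. by exists [::]. Qed.

Lemma gwalk_trans u v w : gwalk u v -> gwalk v w -> gwalk u w.
Proof.
by move=> [s [ps <-]] [t [pt <-]]; exists (s ++ t); rewrite cat_path ps last_cat.
Qed.

Lemma gwalk_adj u v : gadj G u v -> gwalk u v.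
Proof. by move=> uv; exists [:: v]; rewrite /= andbT; split=> //; apply/asboolP. Qed.

Lemma within_gwalk k (psi : {ffun 'I_k -> bool} -> T) (W : {set {ffun 'I_k -> bool}}) x y :
  (forall z i, z \in W -> flip i z \in W -> gadj G (psi z) (psi (flip i z))) ->
  within W x y -> gwalk (psi x) (psi y).
Proof.
move=> adj /connectP[s + ->]; elim: s x => [|z s IH] x /=.
  by move=> _; apply: gwalk_refl.
move=> /andP[/and3P[xW zW /existsP[i /eqP zE]] ps].
by apply: gwalk_trans (IH z ps); rewrite zE in zW *; apply/gwalk_adj/adj.
Qed.

End GraphConnectivity.

Lemma card_le_labels (T : Type) (V : finType) (psi : V -> T) (A : {set V}) (Y : set T) m :
  injective psi -> (forall x, x \in A -> Y (psi x)) -> (m <= #|A|)%N -> (`I_m #<= Y)%card.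
Proof.
move=> inj AY mA; case: m mA => [|m] mA.
  by rewrite II0; apply: card_ge0.
have [x0 x0A] : exists x, x \in A by apply/card_gt0P/(leq_trans _ mA).
have lt t : (t < m.+1)%N -> (t < size (enum A))%N by move=> h; rewrite -cardE (leq_trans h).
have [f] : $|{injfun `I_m.+1 >-> Y}|.
  apply/injfunPex; exists (fun t => psi (nth x0 (enum A) t)).
    by move=> t /= /lt tA; apply: AY; rewrite -mem_enum mem_nth.
  move=> s t; rewrite !classical_sets.in_setE /= => /lt sA /lt tA /inj /eqP.
  by rewrite nth_uniq ?enum_uniq // => /eqP.
exact: inj_card_le f.
Qed.

Section MainArgument.
Local Open Scope classical_set_scope.
Local Open Scope ring_scope.
Context {R : realType} {n : nat} {I : finType} (a : I -> 'rV[R]_n).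
Implicit Types (Z C D : {set I}) (u v w : 'rV[R]_n) (X : set 'rV[R]_n).

Local Notation hull := (hull a).
Local Notation pt := (pt a).
Local Notation P := (hull setT).

Lemma is_face_hull Z : iface pt setT Z -> is_face P (hull Z).
Proof. by move=> fZ; apply/is_faceP; exists Z. Qed.

Lemma face_of_face C F : iface pt setT C -> is_face (hull C) F -> is_face P F.
Proof.
by move=> fC /is_faceP[Z fZ ->]; apply: is_face_hull; apply: iface_trans fC fZ.
Qed.

Lemma vertex_in_face C v : iface pt setT C -> vertices P v -> hull C v ->
  vertices (hull C) v.
Proof.
move=> fC /is_faceP[Z fZ e] Cv; apply/is_faceP; exists Z => //.
have ZC : Z \subset C.
  by apply: (hull_subP fC (subsetT _)); rewrite -e => _ ->.
by have := iface_restrict (subsetT C) fZ; rewrite (setIidPl ZC).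
Qed.

Lemma vertices_in Q v : vertices Q v -> Q v.
Proof. by move=> [c [b [_ e]]]; have : [set v] v by []; rewrite e => -[]. Qed.

Lemma adj_in_face C u v : iface pt setT C ->
  polytope_adj (hull C) u v -> polytope_adj P u v.
Proof.
move=> fC [Cu Cv uv [fE dE]].
split=> //; [exact: face_of_face Cu|exact: face_of_face Cv|].
by split=> //; apply: face_of_face fE.
Qed.

(** The combinatorial dimension k of a facet is at least its geometric dimension
d, which is the inequality that the counting below relies on. *)
Lemma facet_cube d C : is_cubical_polytope d.+1 P -> (0 < d)%N -> ifacet pt setT C ->
  exists k (psi : {ffun 'I_k -> bool} -> 'rV[R]_n),
    cube_labelling a C psi /\ (d <= k)%N /\ \dim (ispan pt C) = d.+1.
Proof.
move=> [_ dP cub] d0 fC; have dC : \dim (ispan pt C) = d.+1.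
  by have := has_dim_span dP; rewrite (facet_dim fC) => -[].
have [i iC] : exists i, i \in C.
  have [C0|[i iC]] := set_0Vmem C; last by exists i.
  move: dC; rewrite C0 (_ : ispan pt set0 = 0%VS) ?dimv0 //.
  by apply/eqP; rewrite -subv0; apply: ispan_sub => i; rewrite inE.
have [|_ [k eqv]] := cub (hull C).
  split; first by apply: is_face_hull; case: fC.
  by exists d; split=> //; apply: span_has_dim iC dC.
have [psi L] := cube_labelling_exists eqv; exists k, psi; split=> //; split=> //.
by have := dim_label L; rewrite dC ltnS.
Qed.

Section Removal.
Context {d : nat} {Z F : {set I}}.
Hypothesis cubP : is_cubical_polytope d.+3 P.
Hypotheses (fZ : iface pt setT Z) (fF : ifacet pt setT F) (ZF : Z \subset F).

Lemma dimF : \dim (ispan pt F) = d.+3.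
Proof.
by have [_ dP _] := cubP; have := has_dim_span dP; rewrite (facet_dim fF) => -[].
Qed.

(** A vertex cannot have F as its only facet, for F would be that vertex. *)
Lemma small_face_facet D : iface pt setT D -> (\dim (ispan pt D) <= 1)%N ->
  exists C, [/\ ifacet pt setT C, C != F & D \subset C].
Proof.
move=> fD dD; apply: sub_ifacet_neq => //.
  apply/eqP=> DT; move: dD; rewrite DT; have [_ dP _] := cubP.
  by rewrite (has_dim_span dP).
by apply/eqP=> DF; move: dD; rewrite DF dimF.
Qed.

Lemma vertex_facet v : vertices P v ->
  exists C, [/\ ifacet pt setT C, C != F & hull C v].
Proof.
move=> /is_faceP[D fD e]; have [|C [fC CF DC]] := small_face_facet fD.
  apply: leq_trans (_ : \dim <[lift1 v]>%VS <= 1)%N; last by rewrite dim_vline leq_b1.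
  apply: dimvS; apply: ispan_sub => i iD.
  have : [set v] (a i) by rewrite e; apply: hull_in.
  by rewrite /pt => ->; apply: memv_line.
by exists C; split=> //; apply: (hull_subset DC); rewrite -e.
Qed.

Section InFacet.
Context {C : {set I}} {k : nat} {psi : {ffun 'I_k -> bool} -> 'rV[R]_n}.
Hypothesis fC : ifacet pt setT C.
Hypotheses (L : cube_labelling a C psi) (dk : (d.+2 <= k)%N).

Lemma labels_Z : labels a psi (Z :&: C) = labels a psi Z.
Proof.
apply/eqP; rewrite eqEsubset labels_subset ?subsetIl //=.
apply/subsetP=> x /labelsP Zx; apply/labelsP; move: Zx.
have [i iC ->] := label_index L x => Zi; apply: hull_in.
by rewrite in_setI iC andbT (hull_mem fZ).
Qed.

Lemma iface_CZ : iface pt C (Z :&: C).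
Proof. exact: iface_restrict (subsetT _) fZ. Qed.

Lemma labels_Z_pattern :
  labels a psi Z = set0 \/ exists S b, labels a psi Z = pattern S b.
Proof. by rewrite -labels_Z; apply: (label_face L); apply: iface_CZ. Qed.

(** Besides coordinate i, it suffices to keep one coordinate at which x violates the
equations of Z, if Z has vertices in C at all. *)
Lemma unremoved_side x i : x \notin labels a psi Z ->
  exists J : {set 'I_k}, [/\ (k - 2 <= #|J|)%N, i \notin J &
    forall z, z \in subcube J x -> z \notin labels a psi Z].
Proof.
case: labels_Z_pattern => [->|[S [b ->]]] xZ.
  exists (~: [set i])%SET; split; first by rewrite card_coset1; lia.
    by rewrite !inE eqxx.
  by move=> z _; rewrite inE.
have [j jS xj] : exists2 j, j \in S & x j != b j.
  move: xZ; rewrite inE negb_forall => /existsP[j]; rewrite negb_imply => /andP[jS ne].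
  by exists j.
exists (~: [set i; j])%SET; split; first exact: card_coset2.
  by rewrite !inE eqxx.
move=> z /subcubeP zx; apply: contra xj => /patternP/(_ j jS) <-.
by rewrite zx // !inE eqxx orbT.
Qed.

Lemma many_outside : C != F -> (d.+2 <= #|~: labels a psi Z|)%N.
Proof.
move=> CF; have /subsetPn[x _ xZ] :
    ~~ ([set: {ffun 'I_k -> bool}]%SET \subset labels a psi Z).
  apply: contra CF => full; apply/eqP/(ifacet_sub fC fF); apply: subset_trans ZF.
  suff : C \subset Z :&: C by move/subset_trans; apply; apply: subsetIl.
  apply: (label_sub L); [exact: iface_refl|exact: iface_CZ|rewrite labels_Z].
  exact: subset_trans (subsetT _) full.
case: labels_Z_pattern => [l0|[S [b lS]]].
  rewrite l0 setC0 cardsT card_ffun card_bool card_ord.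
  by have := ltn_expl k (ltnSn 1); lia.
have [j jS xj] : exists2 j, j \in S & x j != b j.
  move: xZ; rewrite lS inE negb_forall => /existsP[j]; rewrite negb_imply => /andP[jS ne].
  by exists j.
have sub : subcube (~: [set j]) x \subset ~: labels a psi Z.
  apply/subsetP=> z /subcubeP zx; rewrite in_setC lS.
  by apply: contra xj => /patternP/(_ j jS) <-; rewrite zx // !inE eqxx.
apply: leq_trans (subset_leq_card sub); apply: leq_trans (card_subcube _ _).
have := ltn_expl #|~: [set j]| (ltnSn 1); rewrite card_coset1; lia.
Qed.

End InFacet.

Lemma removal_large :
  ~~ (gverts (gminus (polytope_graph P) (vertices (hull Z))) #<= `I_d.+1)%card.
Proof.
have [|C [fC CF _]] := small_face_facet (iface0 a _).
  rewrite (_ : ispan pt set0 = 0%VS) ?dimv0 //.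
  by apply/eqP; rewrite -subv0; apply: ispan_sub => i; rewrite inE.
have [k [psi [L [dk _]]]] := facet_cube cubP isT fC.
apply/negP=> /(card_le_trans _); set Y := gverts _ => small.
have : (`I_d.+2 #<= Y)%card.
  apply: (card_le_labels (label_inj L)) (many_outside fC L dk CF) => x.
  rewrite in_setC => xZ; split; last first.
    by move/vertices_in => h; case/negP: xZ; apply/labelsP.
  apply: (@face_of_face C); first by case: fC.
  by apply/(label_vertex L); exists x.
by move/small; rewrite card_le_II ltnn.
Qed.

Context {X : set 'rV[R]_n}.
Hypothesis Xsmall : ~~ (`I_d.+1 #<= X)%card.

Definition kept v := [/\ vertices P v, ~ hull Z v & ~ X v].

Let G := gminus (gminus (polytope_graph P) (vertices (hull Z))) X.

Lemma kept_adj u v : kept u -> kept v -> polytope_adj P u v -> gadj G u v.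
Proof.
move=> [_ Zu Xu] [_ Zv Xv] uv.
by split=> //; split=> //; move/vertices_in.
Qed.

Section InFacetMinus.
Context {C : {set I}} {k : nat} {psi : {ffun 'I_k -> bool} -> 'rV[R]_n}.
Hypothesis fC : ifacet pt setT C.
Hypotheses (L : cube_labelling a C psi) (dk : (d.+2 <= k)%N).

Let removed := [set x | `[< X (psi x) >]]%SET.

Lemma card_removed : (#|removed| <= d)%N.
Proof.
rewrite leqNgt; apply: contra Xsmall => lt; apply: card_le_labels (label_inj L) _ lt.
by move=> x; rewrite inE => /asboolP.
Qed.

Lemma kept_label x : x \in ~: (labels a psi Z :|: removed) -> kept (psi x).
Proof.
rewrite !inE negb_or => /andP[/asboolP xZ /asboolP xX]; split=> //.
apply: (@face_of_face C); first by case: fC.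
by apply/(label_vertex L); exists x.
Qed.

Lemma kept_labelled u : kept u -> hull C u ->
  exists2 x, x \in ~: (labels a psi Z :|: removed) & u = psi x.
Proof.
move=> [Pu Zu Xu] Cu; have [x ux] : exists x, u = psi x.
  by apply/(label_vertex L); apply: vertex_in_face => //; case: fC.
exists x => //; rewrite !inE negb_or -ux; apply/andP.
by split; apply/asboolP.
Qed.

Lemma facet_gwalk u v : kept u -> kept v -> hull C u -> hull C v -> gwalk G u v.
Proof.
move=> ku kv Cu Cv; have [x xK ->] := kept_labelled ku Cu.
have [y yK ->] := kept_labelled kv Cv.
apply: within_gwalk (cube_minus_connected (labels_Z_pattern L) _ _ xK yK).
- move=> z i zK fzK; apply: kept_adj; [exact: kept_label|exact: kept_label|].
  by apply: (@adj_in_face C); [case: fC|apply: label_edge L _ _].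
- apply: leq_trans card_removed _; clear -dk; lia.
- by lia.
Qed.

(** A ridge not inside F has at least 2 ^ (k - 2) vertices outside Z, more than X
can remove. *)
Lemma ridge_kept D : ifacet pt C (C :&: D) -> ~~ (C :&: D \subset F) ->
  exists u, [/\ kept u, hull C u & hull D u].
Proof.
move=> fB BF; have dC : (1 < \dim (ispan pt C))%N.
  have [_ dP _] := cubP; have := has_dim_span dP.
  by rewrite (facet_dim fC) => -[->].
have [i [b lB]] := label_facet L fB dC.
have /subsetPn[x xB xZ] : ~~ (labels a psi (C :&: D) \subset labels a psi Z).
  apply: contra BF => sub; apply: subset_trans ZF.
  suff : C :&: D \subset Z :&: C by move/subset_trans; apply; apply: subsetIl.
  by apply: (label_sub L); rewrite ?(labels_Z L) //; [case: fB|apply: iface_CZ].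
have [J [cJ iJ JZ]] := unremoved_side L dk i xZ.
have [|z zJ zX] := @subcube_free _ J x removed.
  apply: leq_ltn_trans (ltn_expl #|J| (ltnSn 1)); apply: leq_trans card_removed _.
  by apply: leq_trans cJ; clear -dk; lia.
have zB : z \in labels a psi (C :&: D).
  rewrite lB; apply/patternP=> j; rewrite inE => /eqP->.
  by move/subcubeP: zJ => -> //; move: xB; rewrite lB => /patternP; apply; rewrite inE.
exists (psi z); split.
- by apply: kept_label; rewrite in_setC in_setU negb_or JZ.
- by apply/labelsP; apply: labels_full L _.
- by apply: (hull_subset (subsetIr C D)); apply/labelsP.
Qed.

End InFacetMinus.

Lemma removal_connected : gconnected G.
Proof.
move=> u v [[Pu Zu] Xu] [[Pv Zv] Xv]; change (gwalk G u v).
have kept_of w : vertices P w -> ~ vertices (hull Z) w -> ~ X w -> kept w.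
  by move=> Pw Zw Xw; split=> // hw; apply/Zw/vertex_in_face.
have ku := kept_of u Pu Zu Xu; have kv := kept_of v Pv Zv Xv.
have [C [fC CF Cu]] := vertex_facet Pu; have [D [fD DF Dv]] := vertex_facet Pv.
move: u ku Cu {Pu Zu Xu}.
pose Q C := forall u, kept u -> hull C u -> gwalk G u v.
apply: (facets_linked (Q := Q) fF fD) fC CF.
- by rewrite eq_sym.
- move=> u ku Du; have [k [psi [L [dk _]]]] := facet_cube cubP isT fD.
  exact: (facet_gwalk fD L dk).
move=> C1 D1 fC1 fD1 fB BF IH u ku Cu.
have [k [psi [L [dk _]]]] := facet_cube cubP isT fC1.
have [w [kw Cw Dw]] := ridge_kept fC1 L dk fB BF.
by apply: gwalk_trans (IH w kw Dw); apply: (facet_gwalk fC1 L dk).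
Qed.

End Removal.

(** The points maximizing a functional that defines Z form a face disjoint from
Z. *)
Lemma vertex_outside Z : iface pt setT Z -> Z != setT ->
  exists2 v, vertices P v & ~ hull Z v.
Proof.
move=> [f vf ->] /zset_neq[i _ fi].
have [j _ jmax] := @Order.TotalTheory.arg_maxP _ _ I i xpredT (ev pt f) isT.
have fj : 0 < ev pt f j.
  by apply: lt_le_trans (jmax i isT); rewrite lt_neqAle eq_sym fi vf ?inE.
pose g : 'cV[R]_(1 + n) := col_mx (ev pt f j)%:M 0 - f.
have gE l : ev pt g l = ev pt f j - ev pt f l.
  rewrite evD evN; congr (_ - _).
  by rewrite [ev _ _ _]affvE col_mxKu col_mxKd mulmx0 !mxE eqxx mulr1n addr0.
have vg : valid pt setT g by move=> l _; rewrite gE subr_ge0; apply: jmax.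
have fg : iface pt setT (zset pt setT g) by exists g.
have jg : j \in zset pt setT g by apply/zsetP; rewrite gE subrr inE.
have [D [l [fD Dg lD hD]]] := face_has_vertex fg jg.
exists (a l); first by rewrite /vertices /= -hD; apply: is_face_hull.
move=> hl; have lf : l \in zset pt setT f.
  by apply: hull_mem hl; rewrite ?inE //; exists f.
have := zset_ev (subsetP Dg l lD); rewrite gE (zset_ev lf) subr0 => f0.
by rewrite f0 ltxx in fj.
Qed.

End MainArgument.

Theorem corollary16 (R : realType) (n d : nat) (P F : set 'rV[R]_n)
    (hP : is_cubical_polytope d P) (hF : is_proper_face P F) :
  gkconnected (d - 2) (gminus (polytope_graph P) (vertices F)).
Proof.
have [[A [/finite_seqP[s ->] PE]] _ _] := hP.
pose a (i : 'I_(size s)) := s`_i.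
have hullE : P = hull a setT.
  rewrite PE /hull; congr conv_hull; apply/funext => x; apply/propext; split.
    move=> /= xs; have lt : (index x s < size s)%N by rewrite index_mem.
    by exists (Ordinal lt); rewrite ?inE // /a /= nth_index.
  by move=> [i _ ->]; apply: mem_nth.
rewrite hullE in hP hF *; case: hF => /is_faceP[Z fZ ->] FP {F PE hullE P}.
have ZT : Z != setT by apply: contra_notN FP => /eqP->.
have [d2|d3] := leqP d 2.
  (* Being 0-connected only means having a vertex. *)
  have -> : (d - 2 = 0)%N by lia.
  split=> [|X _]; last by rewrite II0 card_ge0.
  have [v Pv Zv] := vertex_outside fZ ZT; rewrite II0 card_le0; apply/eqP => e.
  by have : (classical_sets.set0 : set _) v by rewrite -e; split=> // /vertices_in.
case: d hP d3 => [|[|[|d]]] // hP _.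
have [C fC ZC] := sub_ifacet fZ ZT.
have -> : (d.+3 - 2 = d.+1)%N by lia.
split; first exact: removal_large hP fZ fC ZC.
by move=> X _ Xs; exact: (removal_connected hP fZ fC ZC Xs).
Qed.
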